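(* $\mathsf{VSB}_{<\omega}\equiv_{\mathrm{sW}}\mathsf{C}^{\subset}_{\max}$.
   Context: A Weihrauch problem is a relation between instances and solutions (coded as elements of $\mathbb{N}^\mathbb{N}$ or $\mathbb{N}$). $P\le_{\mathrm{sW}}Q$ if there are computable functionals $\Phi,\Psi$ such that for every instance $S$ of $P$, $\Phi(S)$ is an instance of $Q$ and for every solution $R$ of $\Phi(S)$, $\Psi(R)$ is a solution of $S$; $\equiv_{\mathrm{sW}}$ is the induced equivalence. $\mathsf{VSB}_{<\omega}$: instances are pairs $(n,V)$ with $n\in\mathbb{N}$ and $V$ a countable vector space (over a countable field, given as part of the instance) in which every set of $n$ vectors is linearly dependent; solutions are bases of $V$. $\mathsf{C}^{\subset}_{\max}$: instances are pairs $(n,f)$ with $f\colon\mathbb{N}\to$ nonempty finite subsets of $\mathbb{N}$ whose range contains every finite subset of $\mathbb{N}$ of cardinality $\ge n$; solutions are finite $X\subseteq\mathbb{N}$ with $X\notin\operatorname{range}(f)$ and every finite $Y\supsetneq X$ in $\operatorname{range}(f)$. *)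

(* Defs.v *)
From HB Require Import structures.
From mathcomp Require Import all_boot all_order all_algebra.
From mathcomp Require Import finmap.

Set Implicit Arguments.
Unset Strict Implicit.
Unset Printing Implicit Defensive.

Import GRing.Theory.

(** * Computable functionals

Kleene's partial recursive functions relative to an oracle, written as terms
with de Bruijn variables: composition is nesting together with [Let], and the
usual schemes of primitive recursion and minimization bind variables. *)

Definition baire := nat -> nat.

Inductive term : Type :=
| Var of nat
| Zero
| Succ of term
| Oracle of term
| Let of term & term          (* the body binds the value of the first term *)
| Rec of term & term & term   (* base; step, binding counter and accumulator;
                                 number of iterations *)
| Mu of term.                 (* the body binds the candidate *)

(* [eval p t s y]: in environment [s], with oracle [p], the term [t] halts with
   value [y].  Evaluation is strict; [Mu a] is the least [y] with [a] equal to
   [0] at [y], and requires [a] to halt at every smaller argument.  Variables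
   beyond the environment read [0]. *)
Fixpoint eval (p : baire) (t : term) (s : seq nat) (y : nat) : Prop :=
  match t with
  | Var i => y = nth 0 s i
  | Zero => y = 0
  | Succ a => exists2 x, eval p a s x & y = x.+1
  | Oracle a => exists2 x, eval p a s x & y = p x
  | Let a b => exists2 x, eval p a s x & eval p b (x :: s) y
  | Rec a b c => exists n (v : nat -> nat),
      [/\ eval p c s n, eval p a s (v 0),
          forall i, i < n -> eval p b [:: i, v i & s] (v i.+1) & y = v n]
  | Mu a => eval p a (y :: s) 0 /\
      forall i, i < y -> exists z, eval p a (i :: s) z.+1
  end.

(* The partial functional on Baire space computed by [t], as a graph. *)
Definition functional (t : term) (p q : baire) : Prop :=
  forall k, eval p t [:: k] (q k).

(** * Weihrauch problems, on names in Baire space *)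

Record problem : Type := Problem {
  instance : baire -> Prop;
  solution : baire -> baire -> Prop
}.

Definition sW_reducible (P Q : problem) : Prop :=
  exists Phi Psi : term, forall p, instance P p ->
    exists q, [/\ functional Phi p q, instance Q q &
      forall r, solution Q q r ->
        exists2 t, functional Psi r t & solution P p t].

Definition sW_equiv (P Q : problem) : Prop :=
  sW_reducible P Q /\ sW_reducible Q P.

(* A natural number [m] is named by every [r] with [r 0 = m]. *)
Definition nat_of_name (r : baire) : nat := r 0.

Local Open Scope fset_scope.

(* The finite set with canonical index [e]: [x] is a member iff the binary digit
   of weight [2 ^ x] in [e] is 1, so that [e] is the sum of these weights. *)
Definition Dset (e : nat) : {fset nat} :=
  [fset x in iota 0 e | odd (e %/ 2 ^ x)].

(** * Linear algebra in an arbitrary vector space *)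

Section LinearAlgebra.
Variables (F : fieldType) (V : lmodType F).
Local Open Scope ring_scope.

Definition lin_dependent (B : {fset V}) : Prop :=
  exists c : V -> F,
    (exists2 b, b \in B & c b != 0) /\ \sum_(b <- B) c b *: b = 0.

(* A basis is only defined as a finite set: where every set of [n] vectors is
   dependent, all bases have fewer than [n] elements. *)
Definition basis (B : {fset V}) : Prop :=
  ~ lin_dependent B /\
  forall v : V, exists c : V -> F, v = \sum_(b <- B) c b *: b.

End LinearAlgebra.

(** * Bases of vector spaces of bounded dimension *)

(* A name codes finitely many functions of finitely many arguments: the [i]-th
   one applied to the arguments [s]. *)
Definition component (p : baire) (i : nat) (s : seq nat) : nat :=
  p (CodeSeq.code (i :: s)).

(* [p] names [n] and a vector space [V] over a field [F], whose carriers are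
   identified with sets of natural numbers by the injections [cF] and [cV]. The
   name provides the carriers through decision functions, and the constants and
   operations; its values outside the carriers are irrelevant. *)
Record vs_name (p : baire) (n : nat) (F : fieldType) (V : lmodType F)
    (cF : F -> nat) (cV : V -> nat) : Prop := VsName {
  vs_bound : component p 0 [::] = n;
  vs_cF_inj : injective cF;
  vs_cV_inj : injective cV;
  vs_F_carrier : forall x, component p 1 [:: x] != 0 <-> exists a, cF a = x;
  vs_F_zero : component p 2 [::] = cF 0%R;
  vs_F_one : component p 3 [::] = cF 1%R;
  vs_F_add : forall a b, component p 4 [:: cF a; cF b] = cF (a + b)%R;
  vs_F_opp : forall a, component p 5 [:: cF a] = cF (- a)%R;
  vs_F_mul : forall a b, component p 6 [:: cF a; cF b] = cF (a * b)%R;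
  vs_V_carrier : forall x, component p 7 [:: x] != 0 <-> exists v, cV v = x;
  vs_V_zero : component p 8 [::] = cV 0%R;
  vs_V_add : forall u v, component p 9 [:: cV u; cV v] = cV (u + v)%R;
  vs_V_scale : forall a v, component p 10 [:: cF a; cV v] = cV (a *: v)%R
}.

Definition VSB_instance (p : baire) : Prop :=
  exists n (F : fieldType) (V : lmodType F) (cF : F -> nat) (cV : V -> nat),
    vs_name p n cF cV /\
    forall B : {fset V}, #|` B| = n -> lin_dependent B.

(* The structure named by [p] is unique up to an isomorphism commuting with [cF]
   and [cV], so this does not depend on the witnesses. *)
Definition VSB_solution (p r : baire) : Prop :=
  exists n (F : fieldType) (V : lmodType F) (cF : F -> nat) (cV : V -> nat),
    vs_name p n cF cV /\
    exists2 B : {fset V}, basis B & Dset (nat_of_name r) = cV @` B.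

Definition VSB_fin : problem := Problem VSB_instance VSB_solution.

(** * Maximal finite sets outside the range of an enumeration *)

(* [p] names the pair of [p 0] and [fin_enum p]. *)
Definition fin_enum (p : baire) (k : nat) : {fset nat} := Dset (p k.+1).

Definition C_max_instance (p : baire) : Prop :=
  (forall k, fin_enum p k != fset0) /\
  (forall Y : {fset nat}, p 0 <= #|` Y| -> exists k, fin_enum p k = Y).

Definition C_max_solution (p r : baire) : Prop :=
  let X := Dset (nat_of_name r) in
  (forall k, fin_enum p k <> X) /\
  (forall Y : {fset nat}, X `<` Y -> exists k, fin_enum p k = Y).

Definition C_max : problem := Problem C_max_instance C_max_solution.

(* Main.v *)
Require Import Defs.
From HB Require Import structures.
From mathcomp Require Import all_boot all_order all_algebra.
From mathcomp Require Import finmap zify ring.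
From Stdlib Require Import Classical ClassicalEpsilon FunctionalExtensionality.

(** A vector space yields the enumeration of all finite sets that are linearly
dependent or contain a non-vector; the maximal sets missed by it are the bases.

Conversely, let [M] be the largest size of a set missed by an enumeration, which
exists since every set of size [p 0] is enumerated.  For each [m > 0], run through
the finite sets until one of size at least [m] is found that is never enumerated;
this search ends exactly when [m <= M], and for [m = M] it ends with a solution.
Build a rational vector space generated by [e_0] and by one vector for each level
[m > 0] and each candidate tried at that level.  When a candidate is discarded at
stage [s], its vector is declared equal to [N_s e_0], where [N_s] is so large that no
two vectors mentioned so far become equal; this keeps equality decidable.  The
limit has dimension [M + 1].  If every vector carries the candidates that were
current when it was created, then a basis shows [M] by its cardinality, and
the last candidate of level [M] occurs in it, because some basis vector has a
nonzero coordinate at level [M]. *)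

Set Implicit Arguments.
Unset Strict Implicit.
Unset Printing Implicit Defensive.

Import Order.TTheory GRing.Theory Num.Theory.

(** * Total computable functions *)

Definition up (r : nat -> nat) (i : nat) := if i is j.+1 then (r j).+1 else 0.

Fixpoint ren (r : nat -> nat) (t : term) : term :=
  match t with
  | Var i => Var (r i)
  | Zero => Zero
  | Succ a => Succ (ren r a)
  | Oracle a => Oracle (ren r a)
  | Let a b => Let (ren r a) (ren (up r) b)
  | Rec a b c => Rec (ren r a) (ren (up (up r)) b) (ren r c)
  | Mu a => Mu (ren (up r) a)
  end.

Lemma eval_ren p t r s s' y : (forall i, nth 0 s (r i) = nth 0 s' i) ->
  eval p t s' y -> eval p (ren r t) s y.
Proof.
elim: t r s s' y => [i|| a IHa | a IHa | a IHa b IHb | a IHa b IHb c IHc | a IHa]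
  r s s' y rs /=.
- by move=> ->.
- by [].
- by case=> x ax ->; exists x => //; apply: IHa ax.
- by case=> x ax ->; exists x => //; apply: IHa ax.
- case=> x ax bx; exists x; first exact: IHa ax.
  by apply: IHb bx; case.
- case=> n [v [cn a0 bi ->]]; exists n, v; split=> //; [exact: IHc cn | exact: IHa a0 |].
  by move=> i /bi bv; apply: IHb bv => -[|[|j]] //=; apply: rs.
- case=> a0 ai; split; first by apply: IHa a0; case.
  by move=> i /ai[z az]; exists z; apply: IHa az; case.
Qed.

(** Termination is required in every environment but only for oracles in [D]: the search behind
    [axpy] is known to end only for oracles that name instances. *)
Definition computable (D : baire -> Prop) (f : baire -> seq nat -> nat) : Prop :=
  exists t, forall p, D p -> forall e, eval p t e (f p e).

Section Computable.
Variable D : baire -> Prop.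
Implicit Types (f g : baire -> seq nat -> nat) (b : baire -> seq nat -> bool).
Local Notation computable := (computable D).

Lemma comp_ext f g : (forall p, D p -> f p =1 g p) -> computable f -> computable g.
Proof. by move=> fg [t tf]; exists t => p Dp e; rewrite -fg //; apply: tf. Qed.

Lemma comp_var i : computable (fun _ e => nth 0 e i).
Proof. by exists (Var i). Qed.

Lemma comp_weak f : computable f -> computable (fun p e => f p (behead e)).
Proof.
case=> t tf; exists (ren succn t) => p Dp e; apply: (eval_ren _ (tf p Dp _)) => i.
by rewrite nth_behead.
Qed.

Lemma comp_var1 i : computable (fun _ e => nth 0 (behead e) i).
Proof. exact: (comp_weak (comp_var i)). Qed.

Lemma comp_var2 i : computable (fun _ e => nth 0 (behead (behead e)) i).
Proof. exact: (comp_weak (comp_var1 i)). Qed.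

Lemma comp_succ f : computable f -> computable (fun p e => (f p e).+1).
Proof. by case=> t tf; exists (Succ t) => p Dp e; exists (f p e) => //; apply: tf. Qed.

Lemma comp_oracle f : computable f -> computable (fun p e => p (f p e)).
Proof. by case=> t tf; exists (Oracle t) => p Dp e; exists (f p e) => //; apply: tf. Qed.

Lemma comp_const n : computable (fun _ _ => n).
Proof. by elim: n => [|n /comp_succ//]; exists Zero. Qed.

Lemma comp_let f (h : baire -> nat -> seq nat -> nat) : computable f ->
    computable (fun p e => h p (nth 0 e 0) (behead e)) ->
  computable (fun p e => h p (f p e) e).
Proof.
move=> [t tf] [u uh]; exists (Let t u) => p Dp e; exists (f p e); first exact: tf.
exact: (uh p Dp (f p e :: e)).
Qed.

Lemma comp_iteri f g (h : baire -> nat -> nat -> seq nat -> nat) :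
    computable f -> computable g ->
    computable (fun p e => h p (nth 0 e 0) (nth 0 e 1) (behead (behead e))) ->
  computable (fun p e => iteri (f p e) (fun i v => h p i v e) (g p e)).
Proof.
move=> [t tf] [u ug] [w wh]; exists (Rec u w t) => p Dp e.
exists (f p e), (fun n => iteri n (fun i v => h p i v e) (g p e)).
split=> //; [exact: tf | exact: ug | move=> i _].
exact: (wh p Dp [:: i, _ & e]).
Qed.

Lemma comp_mu f (h : baire -> nat -> seq nat -> bool) :
    computable (fun p e => h p (nth 0 e 0) (behead e)) ->
    (forall p, D p -> forall e, h p (f p e) e) ->
    (forall p, D p -> forall e i, h p i e -> f p e <= i) ->
  computable f.
Proof.
move=> ch hf fmin.
have [t th] : computable (fun p e => ~~ h p (nth 0 e 0) (behead e)).
  (* One iteration, made exactly when [h] holds, replaces 1 by 0; this is negation as a number. *)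
  have {ch} := @comp_iteri _ _ (fun _ _ _ _ => 0) ch (comp_const 1) (comp_const 0).
  by apply: comp_ext => p _ e; case: (h _ _ _).
exists (Mu t) => p Dp e; split=> [|i lti].
  by have := th p Dp (f p e :: e); rewrite /= hf.
have := th p Dp (i :: e); rewrite /=.
have [/(fmin p Dp)|_] := boolP (h p i e); first by rewrite leqNgt lti.
by exists 0.
Qed.

(* Arguments are evaluated from left to right and pushed, so the last one is innermost. *)
Definition comp2 (F : baire -> nat -> nat -> nat) :=
  computable (fun p e => F p (nth 0 e 1) (nth 0 e 0)).
Definition comp3 (F : baire -> nat -> nat -> nat -> nat) :=
  computable (fun p e => F p (nth 0 e 2) (nth 0 e 1) (nth 0 e 0)).
Definition comp4 (F : baire -> nat -> nat -> nat -> nat -> nat) :=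
  computable (fun p e => F p (nth 0 e 3) (nth 0 e 2) (nth 0 e 1) (nth 0 e 0)).

Lemma comp_app1 (F : baire -> nat -> nat) f : computable (fun p e => F p (nth 0 e 0)) ->
  computable f -> computable (fun p e => F p (f p e)).
Proof. by move=> cF cf; apply: (@comp_let f (fun p x _ => F p x)). Qed.

Lemma comp_app2 F f g : comp2 F -> computable f -> computable g ->
  computable (fun p e => F p (f p e) (g p e)).
Proof.
move=> cF cf cg; apply: (@comp_let f (fun p x e => F p x (g p e))) => //.
apply: (@comp_let _ (fun p x e => F p (nth 0 e 0) x) (comp_weak cg)).
by apply: comp_ext cF => p _ e; rewrite nth_behead.
Qed.

Lemma comp_app3 F f g h : comp3 F -> computable f -> computable g -> computable h ->
  computable (fun p e => F p (f p e) (g p e) (h p e)).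
Proof.
move=> cF cf cg ch; apply: (@comp_let f (fun p x e => F p x (g p e) (h p e))) => //.
apply: (@comp_let _ (fun p x e => F p (nth 0 e 0) x (h p (behead e))) (comp_weak cg)).
apply: (@comp_let _ (fun p x e => F p (nth 0 (behead e) 0) (nth 0 e 0) x)
          (comp_weak (comp_weak ch))).
by apply: comp_ext cF => p _ e; rewrite !nth_behead.
Qed.

Lemma comp_app4 F f g h k : comp4 F -> computable f -> computable g -> computable h -> computable k ->
  computable (fun p e => F p (f p e) (g p e) (h p e) (k p e)).
Proof.
move=> cF cf cg ch ck.
apply: (@comp_let f (fun p x e => F p x (g p e) (h p e) (k p e))) => //.
apply: (@comp_let _ (fun p x e => F p (nth 0 e 0) x (h p (behead e)) (k p (behead e)))
          (comp_weak cg)).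
apply: (@comp_let _ (fun p x e => F p (nth 0 (behead e) 0) (nth 0 e 0) x
          (k p (behead (behead e)))) (comp_weak (comp_weak ch))).
apply: (@comp_let _ (fun p x e => F p (nth 0 (behead (behead e)) 0)
          (nth 0 (behead e) 0) (nth 0 e 0) x)
          (comp_weak (comp_weak (comp_weak ck)))).
by apply: comp_ext cF => p _ e; rewrite !nth_behead.
Qed.

(** The Boolean is the number of iterations, so the step is taken once or not at all. *)
Lemma comp_if b f g : computable b -> computable f -> computable g ->
  computable (fun p e => if b p e then f p e else g p e).
Proof.
move=> cb cf cg.
have := @comp_iteri _ _ (fun p _ _ e => f p e) cb cg (comp_weak (comp_weak cf)).
by apply: comp_ext => p _ e; case: (b p e).
Qed.

Lemma comp_negb b : computable b -> computable (fun p e => ~~ b p e).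
Proof.
move=> cb; apply: comp_ext (comp_if cb (comp_const 0) (comp_const 1)) => p _ e.
by case: (b p e).
Qed.

Lemma comp_andb b b' : computable b -> computable b' -> computable (fun p e => b p e && b' p e).
Proof.
move=> cb cb'; apply: comp_ext (comp_if cb cb' (comp_const 0)) => p _ e.
by case: (b p e).
Qed.

Lemma comp_orb b b' : computable b -> computable b' -> computable (fun p e => b p e || b' p e).
Proof.
move=> cb cb'; apply: comp_ext (comp_if cb (comp_const 1) cb') => p _ e.
by case: (b p e).
Qed.

Lemma comp_implyb b b' : computable b -> computable b' -> computable (fun p e => b p e ==> b' p e).
Proof.
move=> cb cb'; apply: comp_ext (comp_if cb cb' (comp_const 1)) => p _ e.
by case: (b p e).
Qed.


Lemma comp_addn f g : computable f -> computable g -> computable (fun p e => f p e + g p e).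
Proof.
move=> cf cg; have := comp_iteri (h := fun _ _ v _ => v.+1) cf cg (comp_succ (comp_var 1)).
by apply: comp_ext => p _ e; elim: (f p e) => //= n ->.
Qed.

(** The step returns its counter, whose last value is the predecessor; with no iteration the value
    is 0. *)
Lemma comp_pred f : computable f -> computable (fun p e => (f p e).-1).
Proof.
move=> cf; have := comp_iteri (h := fun _ i _ _ => i) cf (comp_const 0) (comp_var 0).
by apply: comp_ext => p _ e; case: (f p e).
Qed.

Lemma comp_subn f g : computable f -> computable g -> computable (fun p e => f p e - g p e).
Proof.
move=> cf cg.
have := comp_iteri (h := fun _ _ v _ => v.-1) cg cf (comp_pred (comp_var 1)).
by apply: comp_ext => p _ e; elim: (g p e) => [|n IHn] /=; rewrite ?subn0 // subnS -IHn.
Qed.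

Lemma comp_muln f g : computable f -> computable g -> computable (fun p e => f p e * g p e).
Proof.
move=> cf cg; have := comp_iteri (h := fun p _ v e => g p e + v) cf (comp_const 0)
  (comp_addn (comp_weak (comp_weak cg)) (comp_var 1)).
by apply: comp_ext => p _ e; elim: (f p e) => //= n ->; rewrite mulSn.
Qed.

Lemma comp_expn f g : computable f -> computable g -> computable (fun p e => f p e ^ g p e).
Proof.
move=> cf cg; have := comp_iteri (h := fun p _ v e => f p e * v) cg (comp_const 1)
  (comp_muln (comp_weak (comp_weak cf)) (comp_var 1)).
by apply: comp_ext => p _ e; elim: (g p e) => //= n ->; rewrite expnS.
Qed.

Lemma comp_factorial f : computable f -> computable (fun p e => (f p e)`!).
Proof.
move=> cf; have := comp_iteri (h := fun _ i v _ => i.+1 * v) cf (comp_const 1)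
  (comp_muln (comp_succ (comp_var 0)) (comp_var 1)).
by apply: comp_ext => p _ e; elim: (f p e) => //= n ->; rewrite factS.
Qed.

Lemma comp_eq0 f : computable f -> computable (fun p e => f p e == 0).
Proof.
move=> cf; apply: comp_ext (comp_subn (comp_const 1) cf) => p _ e.
by case: (f p e).
Qed.

Lemma comp_leq f g : computable f -> computable g -> computable (fun p e => f p e <= g p e).
Proof. by move=> cf cg; apply: comp_eq0; apply: comp_subn. Qed.

Lemma comp_eqn f g : computable f -> computable g -> computable (fun p e => f p e == g p e).
Proof.
move=> cf cg; apply: comp_ext (comp_andb (comp_leq cf cg) (comp_leq cg cf)) => p _ e.
by rewrite eqn_leq.
Qed.

(** Inside an iteration the accumulator lies between the counter and the outer environment; the
    renaming skips it. *)
Lemma comp_weak2 (h : baire -> nat -> seq nat -> nat) :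
  computable (fun p e => h p (nth 0 e 0) (behead e)) ->
  computable (fun p e => h p (nth 0 e 0) (behead (behead e))).
Proof.
case=> t th; exists (ren (fun i => if i is j.+1 then j.+2 else 0) t) => p Dp e.
have := th p Dp (nth 0 e 0 :: behead (behead e)); apply: eval_ren.
by case=> //= j; rewrite !nth_behead.
Qed.

Lemma comp_sum f (h : baire -> nat -> seq nat -> nat) : computable f ->
    computable (fun p e => h p (nth 0 e 0) (behead e)) ->
  computable (fun p e => \sum_(0 <= i < f p e) h p i e).
Proof.
move=> cf ch; have := comp_iteri (h := fun p i v e => h p i e + v) cf (comp_const 0)
  (comp_addn (comp_weak2 (h := h) ch) (comp_var 1)).
apply: comp_ext => p _ e; elim: (f p e) => [|n IHn]; first by rewrite big_nil.
by rewrite big_nat_recr //= -IHn addnC.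
Qed.

Lemma comp_all f (h : baire -> nat -> seq nat -> bool) : computable f ->
    computable (fun p e => h p (nth 0 e 0) (behead e)) ->
  computable (fun p e => all (fun i => h p i e) (iota 0 (f p e))).
Proof.
move=> cf ch; have := comp_iteri (h := fun p i v e => h p i e * v) cf (comp_const 1)
  (comp_muln (comp_weak2 (h := fun p i e => h p i e : nat) ch) (comp_var 1)).
apply: comp_ext => p _ e; elim: (f p e) => [|n IHn] //.
by rewrite iteriS IHn -[in RHS]addn1 iotaD all_cat /= andbT mulnb andbC.
Qed.

Lemma comp_has f (h : baire -> nat -> seq nat -> bool) : computable f ->
    computable (fun p e => h p (nth 0 e 0) (behead e)) ->
  computable (fun p e => has (fun i => h p i e) (iota 0 (f p e))).
Proof.
move=> cf ch; apply: comp_ext (comp_negb (comp_all (h := fun p i e => ~~ h p i e) cf (comp_negb ch))) => p _ e.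
by rewrite all_predC negbK.
Qed.

Lemma comp_dvdn f g : computable f -> computable g -> computable (fun p e => f p e %| g p e).
Proof.
move=> cf cg; have := comp_has (h := fun p i e => i * f p e == g p e) (comp_succ cg)
  (comp_eqn (comp_muln (comp_var 0) (comp_weak cf)) (comp_weak cg)).
apply: comp_ext => p _ e; congr nat_of_bool; apply/hasP/dvdnP => [[i _ /eqP<-]|[k ->]].
  by exists i.
have [->|f0] := posnP (f p e); first by exists 0; rewrite ?muln0.
by exists k => //; rewrite mem_iota /= ltnS leq_pmulr.
Qed.

Lemma comp_maxn f g : computable f -> computable g -> computable (fun p e => maxn (f p e) (g p e)).
Proof.
move=> cf cg; apply: comp_ext (comp_addn cf (comp_subn cg cf)) => p _ e.
by rewrite maxnE.
Qed.

Lemma comp_bigmax f (h : baire -> nat -> seq nat -> nat) : computable f ->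
    computable (fun p e => h p (nth 0 e 0) (behead e)) ->
  computable (fun p e => \max_(0 <= i < f p e) h p i e).
Proof.
move=> cf ch; have := comp_iteri (h := fun p i v e => maxn (h p i e) v) cf (comp_const 0)
  (comp_maxn (comp_weak2 (h := h) ch) (comp_var 1)).
apply: comp_ext => p _ e; elim: (f p e) => [|n IHn]; first by rewrite big_nil.
by rewrite big_nat_recr //= -IHn maxnC.
Qed.

(** The quotient is the largest [i] with [i * g <= f]; the factor [1 <= g] yields 0 for division by
    0. *)
Lemma comp_divn f g : computable f -> computable g -> computable (fun p e => f p e %/ g p e).
Proof.
move=> cf cg; have := comp_muln (comp_leq (comp_const 1) cg)
  (comp_bigmax (h := fun p i e => i * (i * g p e <= f p e)) (comp_succ cf)
    (comp_muln (comp_var 0)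
       (comp_leq (comp_muln (comp_var 0) (comp_weak cg)) (comp_weak cf)))).
apply: comp_ext => p _ e; case: posnP => [->|g0]; first by rewrite divn0.
rewrite mul1n; apply/eqP; rewrite eqn_leq; apply/andP; split.
  apply/bigmax_leqP_seq => i _ _; have [ig|_] := leqP (i * g p e); last by rewrite muln0.
  by rewrite muln1 leq_divRL.
have le_fg : f p e %/ g p e < (f p e).+1 by rewrite ltnS leq_div.
rewrite (bigD1_seq (f p e %/ g p e)) ?mem_index_iota ?iota_uniq //=.
by rewrite leq_divM muln1 leq_maxl.
Qed.

Lemma comp_logn2 f : computable f -> computable (fun p e => logn 2 (f p e)).
Proof.
move=> cf; have := comp_sum (h := fun p i e => (2 ^ i.+1 %| f p e) : nat) (comp_pred cf)
  (comp_dvdn (comp_expn (comp_const 2) (comp_succ (comp_var 0))) (comp_weak cf)).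
apply: comp_ext => p _ e; case: (f p e) => [|n].
  by rewrite big_nil.
by rewrite (@logn_count_dvd 2) // big_add1.
Qed.

End Computable.

(** * Codes of lists of natural numbers *)

Definition at_ (x i : nat) : nat := nth 0 (CodeSeq.decode x) i.
(** The code of [n :: s] is 2^n (2c + 1) with [c] the code of [s]: the exponent of 2 is the head,
    and dividing by the next power of 2 leaves [c]. *)
Definition tail_code (x : nat) : nat := x %/ 2 ^ (logn 2 x).+1.

Lemma logn_code n s : logn 2 (CodeSeq.code (n :: s)) = n.
Proof.
rewrite /= lognM ?expn_gt0 // pfactorK // [logn 2 _.+1]lognE dvdn2 /= odd_double.
exact: addn0.
Qed.

Lemma tail_codeE n s : tail_code (CodeSeq.code (n :: s)) = CodeSeq.code s.
Proof.
rewrite /tail_code logn_code /= expnS [2 * _]mulnC divnMA mulKn ?expn_gt0 //.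
by rewrite divn2 /= uphalf_double.
Qed.

Lemma decodeE x : x != 0 -> CodeSeq.decode x = logn 2 x :: CodeSeq.decode (tail_code x).
Proof.
rewrite -(CodeSeq.decodeK x); case: (CodeSeq.decode x) => // n s _.
by rewrite logn_code tail_codeE !CodeSeq.codeK.
Qed.

Lemma at_code s i : at_ (CodeSeq.code s) i = nth 0 s i.
Proof. by rewrite /at_ CodeSeq.codeK. Qed.

Lemma at_leq x i : at_ x i <= x.
Proof.
rewrite /at_; have [lti|/(nth_default 0)->//] := ltnP i (size (CodeSeq.decode x)).
by have /allP/(_ _ (mem_nth 0 lti))/ltnW := CodeSeq.gtn_decode x.
Qed.

Lemma at_iter x i : at_ x i = logn 2 (iter i tail_code x).
Proof.
have at0 y : at_ y 0 = logn 2 y.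
  by rewrite /at_; have [->|/decodeE->] := eqVneq y 0; rewrite ?logn0.
elim: i x => [|i IHi] x; first by rewrite at0.
by rewrite iterSr -IHi /at_; have [->|/decodeE->] := eqVneq x 0; rewrite ?nth_nil.
Qed.

(** A list is never longer than its code. *)
Lemma at_default x i : x <= i -> at_ x i = 0.
Proof.
move=> le_xi; rewrite /at_ nth_default // (leq_trans _ le_xi) //.
rewrite -[X in _ <= X]CodeSeq.decodeK; elim: (CodeSeq.decode x) => //= n s IHs.
have: 0 < 2 ^ n by rewrite expn_gt0.
by set c := CodeSeq.code s in IHs *; nia.
Qed.

Lemma at0 i : at_ 0 i = 0.
Proof. exact: at_default. Qed.

Section Codes.
Variable D : baire -> Prop.
Implicit Types f g : baire -> seq nat -> nat.
Local Notation computable := (computable D).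

Lemma comp_at f g : computable f -> computable g -> computable (fun p e => at_ (f p e) (g p e)).
Proof.
move=> cf cg; have ctl := comp_app1 (F := fun _ => tail_code) (comp_divn (comp_var D 0)
  (comp_expn (comp_const D 2) (comp_succ (comp_logn2 (comp_var D 0))))).
have := comp_logn2 (comp_iteri (h := fun _ _ v _ => tail_code v) cg cf
  (ctl _ (comp_var D 1))).
by apply: comp_ext => p _ e; rewrite at_iter.
Qed.

Lemma comp_code_cons f (s : baire -> seq nat -> seq nat) :
  computable f -> computable (fun p e => CodeSeq.code (s p e)) ->
  computable (fun p e => CodeSeq.code (f p e :: s p e)).
Proof.
move=> cf cs; have := comp_muln (comp_expn (comp_const D 2) cf)
  (comp_succ (comp_muln (comp_const D 2) cs)).
by apply: comp_ext => p _ e; rewrite mul2n.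
Qed.

Lemma comp_code_nil : computable (fun _ _ => CodeSeq.code [::]).
Proof. exact: comp_const. Qed.

Lemma comp_odd f : computable f -> computable (fun p e => odd (f p e)).
Proof.
move=> cf; apply: comp_ext (comp_negb (comp_dvdn (comp_const D 2) cf)) => p _ e.
by rewrite dvdn2 negbK.
Qed.

End Codes.

(** * Canonical indices of finite sets *)

Definition bit (e x : nat) : bool := odd (e %/ 2 ^ x).

Lemma bit0 e : bit e 0 = odd e. Proof. by rewrite /bit divn1. Qed.

Lemma bitS e x : bit e x.+1 = bit e./2 x.
Proof. by rewrite /bit expnS divnMA divn2. Qed.

Local Open Scope fset_scope.

Lemma mem_Dset e x : (x \in Dset e) = bit e x.
Proof.
rewrite /Dset in_fset inE /= mem_iota /= -/(bit e x).
case: ltnP => //= le_ex; apply/esym.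
by rewrite /bit divn_small // (leq_ltn_trans le_ex) // ltn_expl.
Qed.

Lemma Dset_ltn e x : x \in Dset e -> x < e.
Proof. by rewrite !inE mem_iota => /andP[]. Qed.

Lemma bit_inj e e' : bit e =1 bit e' -> e = e'.
Proof.
elim/ltn_ind: e e' => e IHe e' eqb.
have [eqo eqh] : odd e = odd e' /\ bit e./2 =1 bit e'./2.
  by split=> [|x]; rewrite -?bit0 -?bitS eqb.
have [e0|e_gt0] := posnP e; last first.
  rewrite -(odd_double_half e) -(odd_double_half e') eqo.
  by congr (_ + _.*2)%N; apply: IHe => //; rewrite -divn2 ltn_Pdiv.
rewrite e0 in eqb *; elim/ltn_ind: e' eqb {eqo eqh} => e' IH eqb.
have odd0 : odd e' = false by rewrite -bit0 -eqb.
have [->//|e'_gt0] := posnP e'; have := odd_double_half e'; rewrite odd0 add0n => <-.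
rewrite -(IH e'./2) // => [|x]; first by rewrite -divn2 ltn_Pdiv.
by rewrite -bitS -eqb bitS.
Qed.

Lemma Dset_inj : injective Dset.
Proof. by move=> e e' eqD; apply: bit_inj => x; rewrite -!mem_Dset eqD. Qed.

Lemma bit_surj n (f : pred nat) : (forall x, n <= x -> f x = false) ->
  exists e, bit e =1 f.
Proof.
elim: n f => [|n IHn] f fn.
  by exists 0 => x; rewrite fn // /bit div0n.
have [e eP] := IHn (fun x => f x.+1) (fun x => fn x.+1).
exists (f 0 + e.*2)%N => -[|x]; first by rewrite bit0 oddD odd_double addbF oddb.
by rewrite bitS half_bit_double eP.
Qed.

Lemma Dset_surj Y : exists e, Dset e = Y.
Proof.
have [e eP] : exists e, bit e =1 [in Y].
  apply: (@bit_surj (\max_(x <- Y) x).+1) => x; apply: contraTF => /= xY.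
  by rewrite -ltnNge ltnS (leq_bigmax_seq (F := id)).
by exists e; apply/fsetP => x; rewrite mem_Dset eP.
Qed.

Definition card_code (e : nat) : nat := \sum_(0 <= x < e) bit e x.

Lemma perm_Dset e : perm_eq (Dset e) [seq x <- iota 0 e | bit e x].
Proof.
apply: uniq_perm; rewrite ?filter_uniq ?iota_uniq ?fset_uniq // => x.
rewrite mem_filter mem_iota /= mem_Dset andbC.
case: ltnP => //= le_ex; apply/negbTE; rewrite -mem_Dset.
by apply/negP => /Dset_ltn; rewrite ltnNge le_ex.
Qed.

Lemma card_Dset e : #|` Dset e| = card_code e.
Proof.
have -> : card_code e = count (bit e) (iota 0 e).
  rewrite /card_code /index_iota subn0 -sum1_count [RHS]big_mkcond.
  by apply: eq_bigr => x _; case: (bit e x).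
by rewrite -size_filter; apply: perm_size (perm_Dset e).
Qed.

Lemma big_Dset (V : nmodType) e (F : nat -> V) :
  (\sum_(x <- Dset e) F x = \sum_(0 <= x < e | bit e x) F x)%R.
Proof. by rewrite (perm_big _ (perm_Dset e)) big_filter /index_iota subn0. Qed.

Create HintDb comp.

#[local] Hint Resolve comp_var comp_var1 comp_var2 comp_const comp_succ comp_addn
  comp_pred comp_subn comp_muln comp_expn comp_factorial comp_leq comp_eqn comp_andb
  comp_orb comp_negb comp_implyb comp_if comp_at comp_code_cons comp_code_nil comp_odd
  comp_dvdn comp_maxn comp_divn comp_logn2 comp_all comp_has comp_bigmax
  comp_sum comp_iteri comp_oracle : comp.

Lemma comp_bit D f g : computable D f -> computable D g -> computable D (fun p e => bit (f p e) (g p e)).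
Proof. by rewrite /bit; auto 20 with comp. Qed.

#[local] Hint Resolve comp_bit : comp.

Lemma comp_card_code D f : computable D f -> computable D (fun p e => card_code (f p e)).
Proof.
by apply: (comp_app1 (F := fun _ => card_code)); rewrite /card_code; auto 20 with comp.
Qed.

#[local] Hint Resolve comp_card_code : comp.

(** * From vector spaces to enumerations *)

(** The scalar multiplying the vector with code [x] is named by entry [x] of the list coded by
    [w]. *)
Definition lincomb (p : baire) (e w i : nat) : nat :=
  iteri i (fun x v => if bit e x then
      component p 9 [:: component p 10 [:: at_ w x; x]; v] else v)
    (component p 8 [::]).

Definition dep_witness (p : baire) (e w : nat) : bool :=
  [&& all (fun x => bit e x ==> (component p 1 [:: at_ w x] != 0)) (iota 0 e),
      has (fun x => bit e x && (at_ w x != component p 2 [::])) (iota 0 e) &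
      lincomb p e w e == component p 8 [::]].

Definition out_of_carrier (p : baire) (e : nat) : bool :=
  has (fun x => bit e x && (component p 7 [:: x] == 0)) (iota 0 e).

(* The default value is the code of the dependent set [{0}]. *)
Definition enum_dependent (p : baire) (k : nat) : nat :=
  if out_of_carrier p (logn 2 k) || dep_witness p (logn 2 k) (tail_code k)
  then logn 2 k else 2 ^ component p 8 [::].

Definition dependent_sets (p : baire) (k : nat) : nat :=
  if k == 0 then component p 0 [::] else enum_dependent p k.-1.

Lemma comp_lincomb D : computable D (fun p e =>
  lincomb p (nth 0 e 2) (nth 0 e 1) (nth 0 e 0)).
Proof. by rewrite /lincomb /component; auto 30 with comp. Qed.

Lemma comp_tail_code D f : computable D f -> computable D (fun p e => tail_code (f p e)).
Proof. by rewrite /tail_code; auto with comp. Qed.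
#[local] Hint Resolve comp_tail_code : comp.

Lemma comp_dependent_sets D : computable D (fun p e => dependent_sets p (nth 0 e 0)).
Proof.
rewrite /dependent_sets /enum_dependent /out_of_carrier /dep_witness /component.
have clin f g h : computable D f -> computable D g -> computable D h ->
    computable D (fun p e => lincomb p (f p e) (g p e) (h p e)).
  exact: (@comp_app3 D lincomb f g h (comp_lincomb D)).
auto 40 with comp.
Qed.

Lemma inj_cancel (T : Type) (t : T) (f : T -> nat) : injective f -> exists g, cancel f g.
Proof.
move=> f_inj; exists (fun x => epsilon (inhabits t) (fun u => f u = x)) => u.
by apply: f_inj; apply: (epsilon_spec (inhabits t) (fun u' => f u' = f u)); exists u.
Qed.

Section Linear.
Variables (p : baire) (n : nat) (F : fieldType) (V : lmodType F).
Variables (cF : F -> nat) (cV : V -> nat).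
Hypothesis pV : vs_name p n cF cV.

Lemma fset_image_code e : (forall x, bit e x -> exists v, cV v = x) ->
  exists B : {fset V}, Dset e = cV @` B.
Proof.
move=> e_cV; have [g cVK] := inj_cancel 0%R (vs_cV_inj pV).
exists (g @` Dset e); apply/fsetP => x; rewrite mem_Dset.
apply/idP/imfsetP => [ex|[_ /imfsetP[y /= ey ->] ->]].
  have [v vx] := e_cV x ex; exists (g x); last by rewrite -vx cVK.
  by apply/imfsetP; exists x; rewrite //= mem_Dset.
by move: ey; rewrite mem_Dset => ey; have [v vy] := e_cV y ey; rewrite -vy cVK vy.
Qed.

Lemma lincombE e w i (f : nat -> F) (g : nat -> V) :
    (forall x, x < i -> bit e x -> cV (g x) = x /\ cF (f x) = at_ w x) ->
  lincomb p e w i = cV (\sum_(0 <= x < i | bit e x) f x *: g x)%R.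
Proof.
elim: i => [|i IHi] fg; first by rewrite big_nil -(vs_V_zero pV).
rewrite /lincomb iteriS -/(lincomb p e w i) IHi => [|x /ltnW]; last exact: fg.
rewrite [in RHS]big_mkcond big_nat_recr //= -big_mkcond; case: ifP => [ei|_]; last by rewrite addr0.
have -> : component p 10 [:: at_ w i; i] = cV (f i *: g i)%R.
  by have [gi fi] := fg i (leqnn _) ei; rewrite -(vs_V_scale pV) gi fi.
by rewrite (vs_V_add pV) addrC.
Qed.

Lemma dep_witnessP e (B : {fset V}) : Dset e = cV @` B ->
  (exists w, dep_witness p e w) <-> lin_dependent B.
Proof.
move=> eB; have [g cVK] := inj_cancel 0%R (vs_cV_inj pV).
have [h cFK] := inj_cancel 0%R (vs_cF_inj pV).
have eg x : bit e x -> cV (g x) = x /\ g x \in B.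
  by rewrite -mem_Dset eB => /imfsetP[v /= vB ->]; rewrite cVK.
have sumB (f : V -> F) : (\sum_(0 <= x < e | bit e x) f (g x) *: g x =
    \sum_(b <- B) f b *: b)%R.
  rewrite -big_Dset eB big_imfset /=; last by move=> u v _ _; apply: (vs_cV_inj pV).
  by apply: eq_bigr => b _; rewrite cVK.
have lt_e x : bit e x -> x < e by rewrite -mem_Dset; apply: Dset_ltn.
split=> [[w /and3P[/allP wF /hasP[x _ /andP[ex wx]] /eqP lin0]]|[c [[b bB cb0] c0]]].
  have hw y : bit e y -> cF (h (at_ w y)) = at_ w y.
    move=> ey; have := wF y; rewrite mem_iota /= lt_e // ey => /(_ isT).
    by move=> /(vs_F_carrier pV)[a <-]; rewrite cFK.
  exists (fun v => h (at_ w (cV v))); split.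
    exists (g x); first by case: (eg x ex).
    apply: contraNneq wx => /(congr1 cF); rewrite (eg x ex).1 hw // => ->.
    by rewrite (vs_F_zero pV).
  rewrite -sumB; apply: (vs_cV_inj pV); rewrite -(vs_V_zero pV) -lin0.
  rewrite (lincombE (f := fun y => h (at_ w y)) (g := g)) => [|y _ ey].
    by congr cV; apply: eq_bigr => y ey; rewrite (eg y ey).1.
  by rewrite hw //; case: (eg y ey).
have bitE v : v \in B -> bit e (cV v) by move=> vB; rewrite -mem_Dset eB in_imfset.
pose w := CodeSeq.code [seq cF (c (g x)) | x <- iota 0 e].
have wE x : bit e x -> at_ w x = cF (c (g x)).
  by move=> ex; rewrite at_code (nth_map 0) ?size_iota ?nth_iota ?lt_e.
exists w; apply/and3P; split.
- apply/allP => x _; apply/implyP => /wE->; apply/(vs_F_carrier pV).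
  by exists (c (g x)).
- apply/hasP; exists (cV b); rewrite ?mem_iota /= ?lt_e ?bitE // wE ?bitE // cVK.
  by rewrite (vs_F_zero pV) (inj_eq (vs_cF_inj pV)).
- rewrite (lincombE (f := fun y => c (g y)) (g := g)) => [|y _ ey].
    by rewrite sumB c0 (vs_V_zero pV).
  by rewrite wE //; case: (eg y ey).
Qed.

Lemma enum_dependentP e : (exists k, enum_dependent p k = e) <->
  (exists2 x, bit e x & forall v, cV v <> x) \/
  (exists2 B : {fset V}, Dset e = cV @` B & lin_dependent B).
Proof.
split=> [[k]|].
  rewrite /enum_dependent; case: ifP => [|_ <-].
    case/orP => [/hasP[x _ /andP[kx x0]] <-|kdep <-].
      left; exists x => // v vx; have := vs_V_carrier pV x.
      by rewrite x0 => -[_ /(_ (ex_intro _ v vx))].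
    have [[x [kx xV]]|allV] := classic (exists x, bit (logn 2 k) x /\ forall v, cV v <> x).
      by left; exists x.
    right; have [x kx|B eB] := @fset_image_code (logn 2 k).
      by apply: NNPP => xV; apply: allV; exists x; split=> // v vx; apply: xV; exists v.
    by exists B => //; apply/(dep_witnessP eB); exists (tail_code k).
  right; exists [fset 0%R].
    rewrite (vs_V_zero pV); apply/fsetP => x; rewrite imfset_fset1 inE mem_Dset /bit.
    have [->|neq] := eqVneq x (cV 0%R); first by rewrite divnn expn_gt0.
    case: (ltngtP x (cV 0%R)) neq => // lt_x _; last first.
      by rewrite divn_small // ltn_exp2l.
    by rewrite -expnB ?(ltnW lt_x) // oddX subn_eq0 leqNgt lt_x.
  exists (fun=> 1%R); split; first by exists 0%R; rewrite ?inE ?oner_eq0.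
  by rewrite big_seq_fset1 scaler0.
have enumE w : out_of_carrier p e || dep_witness p e w ->
    exists k, enum_dependent p k = e.
  (* An index of the enumeration codes a set together with a witness; here they are [e] and [w]. *)
  move=> ew; exists (CodeSeq.code (e :: CodeSeq.decode w)).
  by rewrite /enum_dependent logn_code tail_codeE CodeSeq.decodeK ew.
case=> [[x ex xV]|[B eB /(dep_witnessP eB)[w ew]]]; last first.
  by apply: (enumE w); rewrite ew orbT.
apply: (enumE 0); apply/orP; left; apply/hasP; exists x.
  by rewrite mem_iota -mem_Dset in ex *; rewrite Dset_ltn.
rewrite ex /=; apply: contraT => /(vs_V_carrier pV)[v vx].
by have := xV v vx.
Qed.

End Linear.

(** * Linear dependence and span *)

Section Dependence.
Variables (F : fieldType) (V : lmodType F).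
Implicit Types (B : {fset V}) (c : V -> F) (v : V).
Local Open Scope ring_scope.

Lemma lin_dependentS B B' : B `<=` B' -> lin_dependent B -> lin_dependent B'.
Proof.
move=> sBB' [c [[b bB cb0] c0]]; exists (fun v => if v \in B then c v else 0); split.
  by exists b; rewrite ?bB // (fsubsetP sBB').
rewrite -(big_fset_incl _ sBB') => [|v _ /negbTE->]; last by rewrite scale0r.
by rewrite -[RHS]c0 big_seq [RHS]big_seq; apply: eq_bigr => v ->.
Qed.

(** The coefficient of [v] cannot vanish, since [B] would then be dependent; dividing by it solves
    for [v]. *)
Lemma span_of_dependent B v : ~ lin_dependent B -> v \notin B -> lin_dependent (v |` B) ->
  exists c, v = \sum_(b <- B) c b *: b.
Proof.
move=> indB vB [c [[b bvB cb0]]]; rewrite big_fsetU1 //= => c0.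
have [cv0|cv0] := eqVneq (c v) 0.
  case: indB; exists c; split; last by move: c0; rewrite cv0 scale0r add0r.
  by exists b => //; move: bvB; rewrite !inE => /predU1P[bv|//]; rewrite bv cv0 eqxx in cb0.
exists (fun b => - (c v)^-1 * c b).
move/eqP: c0; rewrite addr_eq0 => /eqP/(congr1 ( *:%R (c v)^-1)).
rewrite scalerA mulVf // scale1r => {1}->; rewrite scalerN scaler_sumr -sumrN.
by apply: eq_bigr => u _; rewrite scalerA mulNr scaleNr.
Qed.

End Dependence.

Lemma fset_sub_card (K : choiceType) (B : {fset K}) n : n <= #|` B| ->
  exists2 B', B' `<=` B & #|` B'| = n.
Proof.
move=> le_nB; exists (seq_fset tt (take n B)).
  by apply/fsubsetP => x; rewrite seq_fsetE => /mem_take.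
by rewrite size_seq_fset undup_id ?take_uniq ?fset_uniq // size_takel.
Qed.

Lemma imfset_inj (K K' : choiceType) (f : K -> K') : injective f ->
  injective (fun A : {fset K} => f @` A).
Proof.
move=> f_inj A B /fsetP AB; apply/fsetP => x.
by have := AB (f x); rewrite !mem_imfset.
Qed.

Lemma VSB_fin_le_C_max : sW_reducible VSB_fin C_max.
Proof.
have [Phi PhiE] := comp_dependent_sets (fun _ => True).
(* The backward functional is the identity: a maximal missed set already is a basis. *)
exists Phi, (Oracle (Var 0)) => p [n [F [V [cF [cV [pV Vn]]]]]].
have enumP Y : (exists k, fin_enum (dependent_sets p) k = Y) <->
    (exists2 x, x \in Y & forall v, cV v <> x) \/
    (exists2 B : {fset V}, Y = cV @` B & lin_dependent B).
  have [e <-] := Dset_surj Y; split=> [[k ke]|Ye].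
    have [|[x ex xV]|] := (enum_dependentP pV e).1; [|by left; exists x; rewrite ?mem_Dset|by right].
    by exists k; apply: Dset_inj ke.
  have [|k ke] := (enum_dependentP pV e).2; last by exists k; rewrite -ke.
  by case: Ye => [[x ex xV]|]; [left; exists x; rewrite -?mem_Dset | right].
exists (dependent_sets p); split; first by move=> k; apply: (PhiE p I [:: k]).
  split=> [k|Y]; last first.
    rewrite /dependent_sets /= (vs_bound pV) => le_nY; apply/enumP.
    have [[x [xY xV]]|allV] := classic (exists x, x \in Y /\ forall v, cV v <> x).
      by left; exists x.
    have [e eY] := Dset_surj Y.
    have [x ex|B eB] := @fset_image_code _ _ _ _ _ _ pV e.
      apply: NNPP => xV; apply: allV; exists x; split=> [|v vx]; last by apply: xV; exists v.
      by rewrite -eY mem_Dset.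
    right; exists B; first by rewrite -eY.
    (* A subset of exactly [n] vectors is dependent by assumption, and dependence passes to
       supersets. *)
    have [|B' sB'B B'n] := @fset_sub_card _ B n.
      by rewrite -eY eB card_imfset // in le_nY; apply: (vs_cV_inj pV).
    exact: lin_dependentS sB'B (Vn B' B'n).
  have [|[x xk _]|[B -> [c [[b bB _] _]]]] := (enumP (fin_enum (dependent_sets p) k)).1.
  - by exists k.
  - by apply/fset0Pn; exists x.
  - by apply/fset0Pn; exists (cV b); apply: in_imfset.
move=> r [r_out r_max]; exists r; first by move=> k; exists k.
exists n, F, V, cF, cV; split=> //.
have [x ex|B eB] := @fset_image_code _ _ _ _ _ _ pV (nat_of_name r).
  apply: NNPP => xV; have [|k kr] := (enumP (Dset (nat_of_name r))).2.
    by left; exists x; rewrite ?mem_Dset // => v vx; apply: xV; exists v.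
  exact: r_out kr.
have Bind : ~ lin_dependent B.
  by move=> Bdep; have [|k /r_out//] := (enumP (Dset (nat_of_name r))).2; right; exists B.
exists B => //; split=> // v; have [vB|vB] := boolP (v \in B).
  exists (fun u => if u == v then 1 else 0)%R.
  rewrite (big_fsetD1 v) //= eqxx scale1r big1_seq ?addr0 // => u /=.
  by rewrite !inE => /andP[/negbTE-> _]; rewrite scale0r.
(* By maximality this larger set is enumerated; all its members are vectors, so it must be
   dependent, which puts [v] in the span of [B]. *)
have vB' : Dset (nat_of_name r) `<` cV v |` (cV @` B).
  rewrite eB fproperEneq fsubsetUr andbT; apply: contraNneq vB => /fsetP/(_ (cV v)).
  by rewrite !inE eqxx /= => /imfsetP[u /= uB /(vs_cV_inj pV)->].
case/r_max/enumP: vB' => [[x]|[B']].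
  by rewrite !inE => /predU1P[->|/imfsetP[u /= _ ->]] xV; [case: (xV v) | case: (xV u)].
move=> eBB' B'dep; apply: (span_of_dependent Bind vB); suff -> : v |` B = B' by [].
apply: (imfset_inj (vs_cV_inj pV)); rewrite -eBB'.
by rewrite [LHS]imfsetU imfset_fset1.
Qed.

(** * Minimal codes *)

Definition least (P : pred nat) : nat :=
  if excluded_middle_informative (exists n, P n) is left h then ex_minn h else 0.

Lemma leastP (P : pred nat) : (exists n, P n) ->
  P (least P) /\ forall i, P i -> least P <= i.
Proof.
by rewrite /least => h; case: excluded_middle_informative => // h'; case: ex_minnP.
Qed.

Section MinimalCodes.
Variables (T : eqType) (val : nat -> T).
Hypothesis val_surj : forall v, exists x, val x = v.

(** Least codes are canonical representatives: several codes may denote one value, but the carrier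
    maps of a name must be injective. *)
Definition least_code (v : T) : nat := least (fun x => val x == v).

Lemma least_codeP v : val (least_code v) = v /\ forall x, val x = v -> least_code v <= x.
Proof.
have [x /eqP xv] := val_surj v.
have [/eqP vv le_v] := @leastP (fun x => val x == v) (ex_intro _ x xv).
by split=> // y /eqP; apply: le_v.
Qed.

Lemma least_codeK : cancel least_code val.
Proof. by move=> v; case: (least_codeP v). Qed.

(** The set of least codes is decided by a bounded search once equality of values is decidable. *)
Lemma least_codeE x : (exists v, least_code v = x) <->
  all (fun y => val y != val x) (iota 0 x).
Proof.
split=> [[v <-]|/allP x_min].
  apply/allP => y; rewrite mem_iota /= ltnNge least_codeK.
  by apply: contra => /eqP; case: (least_codeP v) => _; apply.
exists (val x); have [vx le_x] := least_codeP (val x).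
apply/eqP; rewrite eqn_leq le_x //= leqNgt; apply/negP => lt_x.
by have := x_min (least_code (val x)); rewrite mem_iota lt_x vx eqxx => /(_ isT).
Qed.

Lemma least_code0 : least_code (val 0) = 0.
Proof. by apply/eqP; rewrite -leqn0; case: (least_codeP (val 0)) => _; apply. Qed.

End MinimalCodes.

(** * The field of rational numbers *)

Section Rationals.
Local Open Scope ring_scope.

(** A difference over a successor: every natural number codes a rational, and no denominator is
    zero. *)
Definition rat_of_code (x : nat) : rat :=
  ((at_ x 0)%:R - (at_ x 1)%:R) / (at_ x 2).+1%:R.

Lemma rat_of_codeE a b d : rat_of_code (CodeSeq.code [:: a; b; d]) = (a%:R - b%:R) / d.+1%:R.
Proof. by rewrite /rat_of_code !at_code. Qed.

Lemma rat_of_code0 : rat_of_code 0 = 0.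
Proof. by rewrite /rat_of_code !at0 subrr mul0r. Qed.

Lemma rat_of_code_surj (q : rat) : exists x, rat_of_code x = q.
Proof.
have [d dE] : exists d, denq q = d.+1%:Z.
  by case: (denq q) (denq_gt0 q) => // -[|d] // _; exists d.
exists (CodeSeq.code [:: `|Num.max (numq q) 0|%N; `|Num.max (- numq q) 0|%N; d]).
rewrite rat_of_codeE -[RHS]divq_num_den dE; congr (_ / _).
rewrite !pmulrn -intrB; congr (_%:~R); lia.
Qed.

(** The equation z = x y + w with denominators cleared and negative terms moved across, so that only
    natural numbers occur. It covers equality, sums, opposites and products alike. *)
Definition fma_test (x y w z : nat) : bool :=
  let X0 := at_ x 0 in let X1 := at_ x 1 in let X := (at_ x 2).+1 in
  let Y0 := at_ y 0 in let Y1 := at_ y 1 in let Y := (at_ y 2).+1 in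
  let W0 := at_ w 0 in let W1 := at_ w 1 in let W := (at_ w 2).+1 in
  let Z0 := at_ z 0 in let Z1 := at_ z 1 in let Z := (at_ z 2).+1 in
  (Z0 * (X * Y * W) + Z * W * (X0 * Y1 + X1 * Y0) + W1 * (X * Y * Z) ==
   Z1 * (X * Y * W) + Z * W * (X0 * Y0 + X1 * Y1) + W0 * (X * Y * Z))%N.

Lemma fma_clear_denom (F : fieldType) (X0 X1 X Y0 Y1 Y W0 W1 W Z0 Z1 Z : F) :
    X != 0 -> Y != 0 -> W != 0 -> Z != 0 ->
  (Z0 * (X * Y * W) + Z * W * (X0 * Y1 + X1 * Y0) + W1 * (X * Y * Z) ==
   Z1 * (X * Y * W) + Z * W * (X0 * Y0 + X1 * Y1) + W0 * (X * Y * Z)) =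
  ((Z0 - Z1) / Z == (X0 - X1) / X * ((Y0 - Y1) / Y) + (W0 - W1) / W).
Proof.
move=> X_neq0 Y_neq0 W_neq0 Z_neq0; rewrite -subr_eq0 -[RHS]subr_eq0.
set l := (X in (X == 0) = _); set r := (X in _ = (X == 0)).
have -> : l = r * (X * Y * W * Z).
  by rewrite /l /r; field; rewrite X_neq0 Y_neq0 W_neq0 Z_neq0.
by rewrite !mulf_eq0 (negbTE X_neq0) (negbTE Y_neq0) (negbTE W_neq0) (negbTE Z_neq0) !orbF.
Qed.

Lemma fma_testE x y w z : fma_test x y w z =
  (rat_of_code z == rat_of_code x * rat_of_code y + rat_of_code w).
Proof.
rewrite /fma_test /rat_of_code -(eqr_nat rat) !(natrM, natrD).
by rewrite fma_clear_denom ?pnatr_eq0.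
Qed.

Definition fma (x y w : nat) : nat := least (fma_test x y w).

Lemma fmaE x y w : fma x y w =
  least_code rat_of_code (rat_of_code x * rat_of_code y + rat_of_code w).
Proof.
rewrite /fma /least_code; congr least.
by apply: functional_extensionality => z; rewrite fma_testE.
Qed.

Definition one_code : nat := CodeSeq.code [:: 1%N; 0%N; 0%N].
Definition opp_one_code : nat := CodeSeq.code [:: 0%N; 1%N; 0%N].

Lemma rat_of_one_code : rat_of_code one_code = 1.
Proof. by rewrite rat_of_codeE subr0 divr1. Qed.

Lemma rat_of_opp_one_code : rat_of_code opp_one_code = -1.
Proof. by rewrite rat_of_codeE sub0r divr1. Qed.

End Rationals.

Section ComputableRationals.
Variable D : baire -> Prop.
Implicit Types f g h k : baire -> seq nat -> nat.

Lemma comp_fma_test f g h k :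
  computable D f -> computable D g -> computable D h -> computable D k ->
  computable D (fun p e => fma_test (f p e) (g p e) (h p e) (k p e)).
Proof.
apply: (@comp_app4 D (fun _ x y w z => fma_test x y w z)).
by rewrite /comp4 /fma_test; auto 40 with comp.
Qed.

Lemma comp_fma f g h : computable D f -> computable D g -> computable D h ->
  computable D (fun p e => fma (f p e) (g p e) (h p e)).
Proof.
apply: (@comp_app3 D (fun _ x y w => fma x y w)).
have fmaP x y w : exists z, fma_test x y w z.
  have [z zE] := rat_of_code_surj (rat_of_code x * rat_of_code y + rat_of_code w)%R.
  by exists z; rewrite fma_testE zE.
apply: (comp_mu (h := fun _ z e => fma_test (nth 0 e 2) (nth 0 e 1) (nth 0 e 0) z)).
- by apply: comp_fma_test; auto with comp.
- by move=> p _ e; case: (leastP (fmaP (nth 0 e 2) (nth 0 e 1) (nth 0 e 0))).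
- by move=> p _ e i; case: (leastP (fmaP (nth 0 e 2) (nth 0 e 1) (nth 0 e 0))) => _; apply.
Qed.

End ComputableRationals.

#[local] Hint Resolve comp_fma_test comp_fma : comp.

Local Open Scope nat_scope.

(** * Candidates *)

(** Every positive level recurs at infinitely many stages. Level 0 never occurs, being reserved for
    e_0. *)
Definition level (s : nat) : nat := (logn 2 s.+1).+1.

Lemma level_recurs m s : 0 < m -> exists2 S, s <= S & level S = m.
Proof.
(* This code exceeds [s] and contains 2 with exponent [m]; the predecessor undoes the [s.+1] in
   [level]. *)
case: m => // m _; exists (CodeSeq.code [:: m; s]).-1.
  by have /and3P[_ lt_s _] := CodeSeq.ltn_code [:: m; s]; case: CodeSeq.code lt_s.
by rewrite /level prednK ?logn_code //= muln_gt0 expn_gt0.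
Qed.

Lemma level_leq s : level s <= s.+1.
Proof. by rewrite /level ltn_logl. Qed.

Definition refuted (p : baire) (m e s : nat) : bool :=
  (card_code e < m) || has (fun i => p i.+1 == e) (iota 0 s).

(** Indices are tried in increasing order, so a positive level settles on its first index that is
    never refuted, if there is one. *)
Definition candidate (p : baire) (m s : nat) : nat :=
  iteri s (fun i v => if (level i == m) && refuted p m v i then v.+1 else v) 0.

(** At such a stage the current generator of level [level s] is declared equal to [weight s] times
    e_0. *)
Definition collapse (p : baire) (s : nat) : bool :=
  refuted p (level s) (candidate p (level s) s) s.

Lemma candidateS p m s :
  candidate p m s.+1 = candidate p m s + ((level s == m) && collapse p s).
Proof.
rewrite /candidate iteriS -/(candidate p m s) /collapse.
case: eqP => [->|_] /=; last by rewrite addn0.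
by case: ifP => _; rewrite ?addn1 ?addn0.
Qed.

Lemma candidate_mono p m s S : s <= S -> candidate p m s <= candidate p m S.
Proof.
move=> /subnK<-; elim: (S - s) => // k IHk; rewrite addSn candidateS.
exact: leq_trans IHk (leq_addr _ _).
Qed.

(** Hence a finite list of tags records all candidates of a stage, missing entries being read as
    0. *)
Lemma candidate_small p m s : s < m -> candidate p m s = 0.
Proof.
elim: s => // s IHs lt_sm; rewrite candidateS IHs ?(ltnW lt_sm) //.
by case: eqP => // sm; have := level_leq s; rewrite sm leqNgt lt_sm.
Qed.

(** * Vectors *)

(* The code [x] of the list [s; d; A; B; T] stands for the vector with coefficient
   [(A_m - B_m) / (d + 1)] on the generator of level [m] that is current at stage [s].
   It is valid if [T] lists the candidates current at stage [s]; otherwise it stands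
   for [0].  Keeping [T] lets a basis be decoded without the oracle. *)

Definition stage (x : nat) : nat := at_ x 0.

Definition tag_of (x m : nat) : nat := at_ (at_ x 4) m.

(** The bound [x] loses nothing: at levels from [x] on, the tag and the candidate at stage [stage x]
    are both 0. *)
Definition valid (p : baire) (x : nat) : bool :=
  all (fun m => tag_of x m == candidate p m (stage x)) (iota 0 x).

Definition coef (p : baire) (x i m : nat) : nat :=
  if valid p x then at_ (at_ x i) m else 0.

(** This is the N_s of the construction. It equals (s+2)! - (s+1)!, so bounds of the form H (s+1)!
    pass from each stage to the next. *)
Definition weight (s : nat) : nat := s.+1 * s.+1`!.

(* The coordinate of [x] at stage [S] and level [m], up to the denominator; [i = 2] and
   [i = 3] select its positive and negative parts. *)
Definition part (p : baire) (x i S m : nat) : nat :=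
  if m == 0 then
    coef p x i 0 + \sum_(0 <= s < S)
      if [&& stage x <= s, collapse p s &
           candidate p (level s) s == candidate p (level s) (stage x)]
      then weight s * coef p x i (level s) else 0
  else if candidate p m (stage x) == candidate p m S then coef p x i m else 0.

Definition coordinate (p : baire) (x S m : nat) : nat :=
  CodeSeq.code [:: part p x 2 S m; part p x 3 S m; at_ x 1].

(* By this stage, [weight] exceeds the coordinates of [a x + y - z] after clearing
   denominators. *)
Definition decision_stage (a x y z : nat) : nat := 3 * (a + x + y + z).+1 ^ 4.

Definition axpy_test (p : baire) (a x y z : nat) : bool :=
  all (fun m => fma_test a (coordinate p x (decision_stage a x y z) m)
                  (coordinate p y (decision_stage a x y z) m)
                  (coordinate p z (decision_stage a x y z) m))
    (iota 0 (a + x + y + z).+1).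

Section ComputableVectors.
Variable D : baire -> Prop.
Implicit Types f g h k : baire -> seq nat -> nat.

Lemma comp_level f : computable D f -> computable D (fun p e => level (f p e)).
Proof. by rewrite /level; auto with comp. Qed.
#[local] Hint Resolve comp_level : comp.

Lemma comp_refuted f g h : computable D f -> computable D g -> computable D h ->
  computable D (fun p e => refuted p (f p e) (g p e) (h p e)).
Proof.
by apply: (@comp_app3 D refuted); rewrite /comp3 /refuted; auto 20 with comp.
Qed.
#[local] Hint Resolve comp_refuted : comp.

Lemma comp_candidate f g : computable D f -> computable D g ->
  computable D (fun p e => candidate p (f p e) (g p e)).
Proof.
by apply: (@comp_app2 D candidate); rewrite /comp2 /candidate; auto 20 with comp.
Qed.
#[local] Hint Resolve comp_candidate : comp.

Lemma comp_collapse f : computable D f -> computable D (fun p e => collapse p (f p e)).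
Proof.
by apply: (comp_app1 (F := collapse)); rewrite /collapse; auto 20 with comp.
Qed.
#[local] Hint Resolve comp_collapse : comp.

Lemma comp_coef f g h : computable D f -> computable D g -> computable D h ->
  computable D (fun p e => coef p (f p e) (g p e) (h p e)).
Proof.
apply: (@comp_app3 D coef); rewrite /comp3 /coef /valid /tag_of /stage.
by auto 20 with comp.
Qed.
#[local] Hint Resolve comp_coef : comp.

Lemma comp_part f g h k : computable D f -> computable D g -> computable D h ->
  computable D k -> computable D (fun p e => part p (f p e) (g p e) (h p e) (k p e)).
Proof.
apply: (@comp_app4 D part); rewrite /comp4 /part /stage /weight.
by auto 20 with comp.
Qed.
#[local] Hint Resolve comp_part : comp.

Lemma comp_coordinate f g h : computable D f -> computable D g -> computable D h ->
  computable D (fun p e => coordinate p (f p e) (g p e) (h p e)).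
Proof.
apply: (@comp_app3 D coordinate); rewrite /comp3 /coordinate.
by auto 20 with comp.
Qed.
#[local] Hint Resolve comp_coordinate : comp.

Lemma comp_axpy_test f g h k : computable D f -> computable D g -> computable D h ->
  computable D k -> computable D (fun p e => axpy_test p (f p e) (g p e) (h p e) (k p e)).
Proof.
apply: (@comp_app4 D axpy_test); rewrite /comp4 /axpy_test /decision_stage.
by auto 20 with comp.
Qed.

End ComputableVectors.

#[local] Hint Resolve comp_axpy_test : comp.

(** Candidates only increase, so an abandoned one never returns. *)
Lemma candidate_neq p m s S : s <= S -> candidate p m s != candidate p m S ->
  forall S', S <= S' -> candidate p m s != candidate p m S'.
Proof.
move=> sS neq S' /(candidate_mono p m) SS'.
by rewrite neq_ltn (leq_trans _ SS') // ltn_neqAle neq candidate_mono.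
Qed.

(** * Evolution of the coordinates over the stages *)

Section Parts.
Variable p : baire.

(** Together with [partS], this is the linear map that substitutes [weight S] times e_0 for the
    generator collapsing at stage [S]. *)
Lemma partS0 x i S : stage x <= S -> part p x i S.+1 0 =
  part p x i S 0 + (if collapse p S then weight S * part p x i S (level S) else 0).
Proof.
move=> xS; rewrite /part /= big_nat_recr //= xS addnA; congr (_ + _).
rewrite [candidate p (level S) S == _]eq_sym.
by case: (collapse p S) => //=; case: ifP; rewrite ?muln0.
Qed.

Lemma partS x i S m : stage x <= S -> m != 0 -> part p x i S.+1 m =
  if collapse p S && (level S == m) then 0 else part p x i S m.
Proof.
move=> xS /negbTE m0; rewrite /part m0 candidateS [(level S == m) && _]andbC.
case: (collapse p S && (level S == m)); rewrite ?addn0 // addn1.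
by rewrite ltn_eqF // ltnS candidate_mono.
Qed.

Lemma coef_leq x i m : coef p x i m <= x.
Proof.
by rewrite /coef; case: ifP => // _; apply: leq_trans (at_leq _ _) (at_leq _ _).
Qed.

Lemma part_leq x i S m : m != 0 -> part p x i S m <= x.
Proof. by move=> /negbTE m0; rewrite /part m0; case: ifP => // _; apply: coef_leq. Qed.

Lemma part0_stage x i : part p x i (stage x) 0 = coef p x i 0.
Proof.
rewrite /part /= big_nat_cond big1 ?addn0 // => s.
by rewrite andbT /= => lt_s; rewrite leqNgt lt_s.
Qed.

(** A collapse at stage s adds at most [weight s * x], and (s+1)! + [weight s] = (s+2)!. *)
Lemma part0_leq x i S : stage x <= S -> part p x i S 0 <= x * S.+1`!.
Proof.
move=> /subnK<-; elim: (S - stage x) => [|k IHk].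
  by rewrite add0n part0_stage (leq_trans (coef_leq _ _ _)) // leq_pmulr ?fact_gt0.
rewrite addSn partS0 ?leq_addl // [_.+2`!]factS; set s := k + _ in IHk *.
have le_x : part p x i s (level s) <= x by apply: part_leq.
rewrite /weight; set F := s.+1`! in IHk *.
apply: leq_trans (leq_add IHk _) _; last first.
  instantiate (1 := s.+1 * F * x); nia.
by case: ifP => // _; rewrite leq_mul2l le_x orbT.
Qed.

Lemma part_default x i S m : x <= m -> m != 0 -> part p x i S m = 0.
Proof.
move=> le_xm /negbTE m0; rewrite /part m0 /coef.
by rewrite at_default ?(leq_trans (at_leq _ _)) // !if_same.
Qed.

(* The size condition makes [weight S] exceed everything mentioned before stage [S],
   so that a collapse never cancels a nonzero vector. *)
Lemma collapse_injective (W : nat -> nat -> int) (H S0 : nat) :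
    H <= S0 ->
    (forall S, S0 <= S -> W S.+1 0 = (W S 0 +
       if collapse p S then (weight S)%:Z * W S (level S) else 0)%R) ->
    (forall S m, S0 <= S -> m != 0 ->
       W S.+1 m = if collapse p S && (level S == m) then 0%R else W S m) ->
    (forall m, m != 0 -> (`|W S0 m| <= H%:Z)%R) ->
    (`|W S0 0| <= (H * S0.+1`!)%N%:Z)%R ->
  forall S, S0 <= S -> (forall m, W S m = 0%R) <-> (forall m, W S0 m = 0%R).
Proof.
move=> HS0 W0 Wm bm b0 S /subnK<-; elim: (S - S0) => [//|k IHk].
(* The two bounds persist at later stages, the growth of the factorial absorbing each weighted
   term. *)
have [{}bm {}b0] : (forall m, m != 0 -> (`|W (k + S0)%N m| <= H%:Z)%R) /\
    (`|W (k + S0)%N 0| <= (H * (k + S0).+1`!)%N%:Z)%R.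
  elim: k {IHk} => [//|k [IHm IH0]]; rewrite addSn; set s := k + S0 in IHm IH0 *.
  have S0s : S0 <= s by apply: leq_addl.
  split=> [m m0|]; first by rewrite Wm //; case: ifP => // _; apply: IHm.
  rewrite W0 // factS /weight; have := IHm (level s) isT.
  move: IH0; move: (W s 0) (W s (level s)) => u v; set F := s.+1`!.
  case: ifP => _ bu bv; last by rewrite addr0 (le_trans bu) // lez_nat; nia.
  rewrite (le_trans (ler_normD _ _)) // normrM.
  have : (`|(s.+1 * F)%N%:Z| * `|v| <= (s.+1 * F)%N%:Z * H%:Z)%R.
    by rewrite ler_wpM2l // normr_ge0.
  nia.
rewrite addSn -IHk; set s := k + S0 in bm b0 *; have S0s : S0 <= s by apply: leq_addl.
split=> Ws m; last first.
  by have [->|m0] := eqVneq m 0; rewrite ?W0 ?Wm ?Ws ?mulr0 ?if_same ?addr0.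
have [act|act] := boolP (collapse p s); last first.
  have [m0|m0] := eqVneq m 0; last by have := Ws m; rewrite Wm // (negbTE act).
  by have := Ws 0; rewrite W0 // (negbTE act) addr0 m0.
have := Ws 0; rewrite W0 // act => W00.
(* Otherwise cancellation would force coordinate 0 to be at least (s+1) (s+1)! in absolute value,
   but it is at most H (s+1)! with H <= s. *)
have Wl : W s (level s) = 0%R.
  apply/eqP; apply: contraT => Wl0.
  have : (`|W s 0| = (weight s)%:Z * `|W s (level s)|)%R.
    rewrite -[X in (X * _)%R]ger0_norm // -normrM -normrN; congr (`|_|)%R.
    by apply/eqP; rewrite -subr_eq0 -opprD oppr_eq0 W00.
  have : (1 <= `|W s (level s)|)%R by rewrite -gtz0_ge1 normr_gt0.
  move: b0; rewrite /weight; have := fact_gt0 s.+1; set F := s.+1`!.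
  by move: (`|_|)%R (`|_|)%R => u v; nia.
have [m0|m0] := eqVneq m 0; first by move: W00; rewrite Wl mulr0 addr0 m0.
have [<-//|ne] := eqVneq (level s) m.
by have := Ws m; rewrite Wm // (negbTE ne) andbF.
Qed.

(** The coordinate of a x + y - z times a common denominator that depends on neither [S] nor [m], so
    that the recurrences for parts carry over to integers. *)
Definition axpy_defect (a x y z S m : nat) : int :=
  (
  ((at_ a 0)%:Z - (at_ a 1)%:Z) * ((at_ y 1).+1 * (at_ z 1).+1)%N%:Z *
    ((part p x 2 S m)%:Z - (part p x 3 S m)%:Z)
  + ((at_ a 2).+1 * ((at_ x 1).+1 * (at_ z 1).+1))%N%:Z *
    ((part p y 2 S m)%:Z - (part p y 3 S m)%:Z)
  - ((at_ a 2).+1 * ((at_ x 1).+1 * (at_ y 1).+1))%N%:Z *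
    ((part p z 2 S m)%:Z - (part p z 3 S m)%:Z))%R.

Lemma axpy_defectE a x y z S m :
  fma_test a (coordinate p x S m) (coordinate p y S m) (coordinate p z S m) =
  (axpy_defect a x y z S m == 0%R).
Proof.
rewrite fma_testE !rat_of_codeE -(intr_eq0 rat) /axpy_defect.
rewrite !(rmorphB, rmorphD, rmorphM) /= -!pmulrn !natrM /rat_of_code.
have nz n : (n.+1%:R != 0 :> rat)%R by rewrite pnatr_eq0.
move: (nz (at_ a 2)) (nz (at_ x 1)) (nz (at_ y 1)) (nz (at_ z 1)).
set A : rat := (at_ a 2).+1%:R%R; set X : rat := (at_ x 1).+1%:R%R.
set Y : rat := (at_ y 1).+1%:R%R; set Z : rat := (at_ z 1).+1%:R%R.
clearbody A X Y Z; move=> A0 X0 Y0 Z0; rewrite eq_sym -subr_eq0; set l := (X in (X == _) = _).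
set r := (X in _ = (X == _)).
have -> : (r = l * (A * X * Y * Z))%R.
  by rewrite /l /r; field; rewrite A0 X0 Y0 Z0.
by rewrite !mulf_eq0 (negbTE A0) (negbTE X0) (negbTE Y0) (negbTE Z0) !orbF.
Qed.

Lemma norm_subz_leq (u v : nat) (H : nat) : u <= H -> v <= H ->
  (`|u%:Z - v%:Z| <= H%:Z)%R.
Proof. lia. Qed.

(** Each of the three terms is at most [c ^ 3 * H]; taking [H] to be [c] explains [3 * c ^ 4] in
    [decision_stage]. *)
Lemma norm_axpy (A1 A2 D1 D2 D3 D4 c H : nat) (u v w : int) :
    A1 < c -> A2 < c -> D1 <= c -> D2 <= c -> D3 <= c -> D4 <= c ->
    (`|u| <= H%:Z)%R -> (`|v| <= H%:Z)%R -> (`|w| <= H%:Z)%R ->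
  (`|(A1%:Z - A2%:Z) * (D2 * D3)%N%:Z * u + (D4 * (D1 * D3))%N%:Z * v
     - (D4 * (D1 * D2))%N%:Z * w| <= (3 * c ^ 3 * H)%N%:Z)%R.
Proof.
move=> A1c A2c D1c D2c D3c D4c uH vH wH.
have mulH (k : int) (t : int) : (`|k| <= (c ^ 3)%N%:Z)%R -> (`|t| <= H%:Z)%R ->
    (`|k * t| <= (c ^ 3 * H)%N%:Z)%R.
  by move=> kc tH; rewrite normrM PoszM ler_pM.
have cube (i j k : nat) : i <= c -> j <= c -> k <= c -> i * (j * k) <= c ^ 3.
  by move=> ic jc kc; rewrite expnS expnS expn1 !leq_mul.
have -> : Posz (3 * c ^ 3 * H) = (Posz (c ^ 3 * H) + Posz (c ^ 3 * H) + Posz (c ^ 3 * H))%R.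
  by rewrite -!PoszD; congr Posz; ring.
rewrite (le_trans (ler_normB _ _)) // lerD ?mulH //; last by rewrite lez_nat cube.
rewrite (le_trans (ler_normD _ _)) // lerD ?mulH //; last by rewrite lez_nat cube.
rewrite normrM expnS [Posz (c * _)]PoszM ler_pM ?norm_subz_leq ?(ltnW A1c) ?(ltnW A2c) //.
by rewrite lez_nat -mulnn leq_mul.
Qed.

(** The test inspects only the decision stage; from there on collapses are injective on the defect,
    so its vanishing is the same at all later stages. *)
Lemma axpy_testP a x y z S : decision_stage a x y z <= S ->
  axpy_test p a x y z <-> forall m, axpy_defect a x y z S m = 0%R.
Proof.
pose c := (a + x + y + z).+1; set S0 := decision_stage _ _ _ _ => leS.
have le_c : c <= S0.
  rewrite /S0 /decision_stage -/c -{1}[c]expn1.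
  by rewrite (leq_trans (@leq_pexp2l c 1 4 _ _)) // leq_pmull.
have xS : stage x <= S0 by apply: leq_trans (at_leq _ _) (leq_trans _ le_c); rewrite /c; lia.
have yS : stage y <= S0 by apply: leq_trans (at_leq _ _) (leq_trans _ le_c); rewrite /c; lia.
have zS : stage z <= S0 by apply: leq_trans (at_leq _ _) (leq_trans _ le_c); rewrite /c; lia.
have test0 : axpy_test p a x y z <-> forall m, axpy_defect a x y z S0 m = 0%R.
  rewrite /axpy_test -/S0 -/c; split=> [/allP tst m|W0]; last first.
    by apply/allP => m _; rewrite axpy_defectE W0.
  have [lt_mc|le_cm] := ltnP m c.
    by apply/eqP; rewrite -axpy_defectE; apply: tst; rewrite mem_iota.
  (* All codes involved are below [c], so they have no coordinates at levels from [c] on. *)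
  by rewrite /axpy_defect !part_default ?subrr ?mulr0 ?addr0 ?subrr //; rewrite /c in le_cm; lia.
rewrite test0; symmetry; apply: (@collapse_injective _ S0) => //.
- move=> s S0s; rewrite /axpy_defect !partS0 ?(leq_trans _ S0s) //.
  by case: ifP => _; rewrite ?addn0 ?addr0 // !PoszD !PoszM; ring.
- move=> s m S0s m0; rewrite /axpy_defect !partS ?(leq_trans _ S0s) //.
  by case: ifP => // _; rewrite !subrr !mulr0.
- move=> m m0; have -> : Posz S0 = Posz (3 * c ^ 3 * c).
    by rewrite /S0 /decision_stage -/c; congr Posz; rewrite [c ^ 4]expnSr mulnA.
  have at_c u i : u < c -> at_ u i < c by apply: leq_ltn_trans (at_leq _ _).
  have part_c u i : u < c -> part p u i S0 m <= c.
    by move=> /ltnW uc; apply: leq_trans (part_leq _ _ _ m0) uc.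
  apply: norm_axpy; rewrite ?at_c ?norm_subz_leq ?part_c // ?/c; lia.
- have -> : Posz (S0 * S0.+1`!) = Posz (3 * c ^ 3 * (c * S0.+1`!)).
    by congr Posz; rewrite /S0 {1}/decision_stage -/c [c ^ 4]expnSr; ring.
  have at_c u i : u < c -> at_ u i < c by apply: leq_ltn_trans (at_leq _ _).
  have part_c u i : u < c -> stage u <= S0 -> part p u i S0 0 <= c * S0.+1`!.
    by move=> /ltnW uc uS; rewrite (leq_trans (part0_leq _ uS)) // leq_mul2r uc orbT.
  apply: norm_axpy; rewrite ?at_c ?norm_subz_leq ?part_c // ?/c; lia.
Qed.

End Parts.

(** * The limit of the construction *)

(** Induction on the room [b - f s] below the bound, which shrinks whenever the value changes. *)
Lemma bounded_mono_stable (f : nat -> nat) b : {homo f : s S / s <= S} ->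
  (forall s, f s <= b) -> exists s0, forall s, s0 <= s -> f s = f s0.
Proof.
move=> f_mono f_b; suff stab : forall k s, b - f s <= k ->
    exists s0, forall S, s0 <= S -> f S = f s0 by apply: (stab _ 0 (leqnn _)).
elim=> [|k IHk] s le_k.
  by exists s => S sS; have := f_mono _ _ sS; have := f_b S; lia.
have [[S sS fS]|stable] := classic (exists2 S, s <= S & f S <> f s).
  by apply: (IHk S); have := f_mono _ _ sS; have := f_b S; lia.
by exists s => S sS; apply: NNPP => fS; apply: stable; exists S.
Qed.

Section Limit.
Variable p : baire.
Hypothesis pI : C_max_instance p.

Definition missed (m : nat) : Prop :=
  exists2 e, m <= card_code e & forall i, p i.+1 != e.

Lemma fin_enumE k e : (fin_enum p k = Dset e) <-> p k.+1 == e.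
Proof. by rewrite /fin_enum; split=> [/Dset_inj->|/eqP->]. Qed.

Lemma fin_enum_neq0 k : p k.+1 != 0.
Proof.
apply/negP => /eqP p0; have /fset0Pn[x] := pI.1 k.
by rewrite /fin_enum p0 mem_Dset /bit div0n.
Qed.

Lemma missed_lt m : missed m -> m < p 0.
Proof.
move=> [e le_e eP]; rewrite ltnNge; apply/negP => le_m.
have [|k /fin_enumE] := pI.2 (Dset e); last by rewrite (negbTE (eP k)).
by rewrite card_Dset (leq_trans le_m).
Qed.

Lemma missed_top : exists M, missed M /\ forall m, M < m -> ~ missed m.
Proof.
(* The empty set, with index 0, is never enumerated, since all enumerated sets are nonempty. *)
have missed0 : missed 0 by exists 0 => // i; apply: fin_enum_neq0.
apply: NNPP => noM; suff: forall m, missed m by move/(_ (p 0))/missed_lt; rewrite ltnn.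
elim=> // m mm; apply: NNPP => nm; apply: noM; exists m; split=> // m' lt_m [e le_e eP].
by apply: nm; exists e => //; apply: leq_trans le_e.
Qed.

(** A refutation would persist until the next stage of level [m] and replace the candidate there. *)
Lemma candidate_missed m s0 : 0 < m ->
    (forall s, s0 <= s -> candidate p m s = candidate p m s0) ->
  m <= card_code (candidate p m s0) /\ forall i, p i.+1 != candidate p m s0.
Proof.
move=> m_gt0 stable; set c := candidate p m s0 in stable *.
have unrefuted s : s0 <= s -> ~~ refuted p m c s.
  move=> s0s; have [S sS lS] := level_recurs s m_gt0.
  have s0S := leq_trans s0s sS; apply/negP => ref.
  have := stable S.+1 (leqW s0S); rewrite candidateS lS eqxx stable //.
  suff -> : collapse p S by move/eqP; rewrite addn1 eqn_leq ltnn.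
  rewrite /collapse lS stable // /refuted; case/orP: ref => [->//|/hasP[i]].
  rewrite mem_iota /= => lt_i pi; apply/orP; right; apply/hasP; exists i => //.
  by rewrite mem_iota (leq_trans lt_i).
split=> [|i].
  by have := unrefuted _ (leqnn _); rewrite /refuted negb_or -leqNgt => /andP[].
have := unrefuted (maxn s0 i.+1) (leq_maxl _ _); rewrite /refuted negb_or.
by case/andP=> _ /hasPn/(_ i); apply; rewrite mem_iota /= leq_maxr.
Qed.

(** The candidate cannot pass a missed index of size at least [m], because that index is never
    refuted. *)
Lemma candidate_stable m : missed m ->
  exists s0, forall s, s0 <= s -> candidate p m s = candidate p m s0.
Proof.
case=> e le_e eP; apply: (@bounded_mono_stable _ e); first exact: candidate_mono.
elim=> // s IHs; rewrite candidateS; case: eqP => [lm|_]; last by rewrite addn0.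
move: IHs; rewrite leq_eqVlt => /predU1P[ce|lt_e].
  suff /negbTE-> : ~~ collapse p s by rewrite addn0 ce.
  rewrite /collapse /refuted lm ce negb_or -leqNgt le_e /=; apply/hasPn => i _.
  exact: eP.
by apply: leq_trans lt_e; rewrite -[X in _ <= X]addn1 leq_add2l leq_b1.
Qed.

Variable M : nat.
Hypotheses (missedM : missed M) (not_missed : forall m, M < m -> ~ missed m).

Lemma candidates_stable : exists s0, forall m s, m <= M -> s0 <= s ->
  candidate p m s = candidate p m s0.
Proof.
have missed_le : forall m, m <= M -> missed m.
  by move=> m le_mM; case: missedM => e le_e eP; exists e; first exact: leq_trans le_e.
elim: M missed_le => [|N IHN] mM.
  have [s0 s0P] := candidate_stable (mM 0 isT).
  by exists s0 => m s; rewrite leqn0 => /eqP->; apply: s0P.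
have [|s0 s0P] := IHN; first by move=> m le_m; apply: mM; apply: leqW.
have [s1 s1P] := candidate_stable (mM N.+1 (leqnn _)).
exists (maxn s0 s1) => m s; rewrite leq_eqVlt geq_max => /predU1P[->|lt_m] /andP[le0 le1].
  by rewrite !s1P ?leq_maxr.
by rewrite !s0P ?leq_maxl.
Qed.

(** A candidate kept forever at a level above [M] would show that this level is missed. *)
Lemma candidates_grow s L : exists2 S, s <= S &
  forall m, M < m < L -> candidate p m s != candidate p m S.
Proof.
elim: L => [|L [S sS SP]]; first by exists s => // m; rewrite ltn0 andbF.
have [ML|le_LM] := ltnP M L; last first.
  by exists S => // m /andP[]; lia.
have [[S' sS' S'P]|stable] :=
    classic (exists2 S', s <= S' & candidate p L s != candidate p L S').
  exists (maxn S S') => [|m]; first by rewrite (leq_trans sS) ?leq_maxl.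
  case/andP=> Mm; rewrite ltnS leq_eqVlt => /predU1P[->|lt_m].
    by apply: candidate_neq S'P _ _; rewrite ?leq_maxr.
  by apply: (candidate_neq sS (SP m _)); rewrite ?Mm ?leq_maxl.
have [|le_L cP] := @candidate_missed L s (leq_ltn_trans (leq0n _) ML).
  move=> S' sS'; apply/eqP; rewrite eq_sym; apply: contraT => neq.
  by case: stable; exists S'.
by case: (not_missed ML); exists (candidate p L s).
Qed.

Variable s0 : nat.
Hypothesis s0P : forall m s, m <= M -> s0 <= s -> candidate p m s = candidate p m s0.

(** By such a stage the levels up to [M] have settled, and all higher generators that [x] can
    mention have collapsed into e_0. *)
Definition limit_stage (x S : nat) : Prop := [/\ s0 <= S, stage x <= S &
  forall m, M < m < x -> candidate p m (stage x) != candidate p m S].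

Lemma limit_stage_exists x : exists S, limit_stage x S.
Proof.
have [S sS SP] := candidates_grow (stage x) x.
exists (maxn S s0); split; rewrite ?leq_maxr ?(leq_trans sS) ?leq_maxl // => m mx.
by apply: (candidate_neq sS (SP m mx)); rewrite leq_maxl.
Qed.

Lemma limit_stageW x S S' : S <= S' -> limit_stage x S -> limit_stage x S'.
Proof.
move=> SS' [s0S xS SP]; split; rewrite ?(leq_trans _ SS') // => m mx.
exact: (candidate_neq xS (SP m mx)).
Qed.

Lemma part_vanish x i S m : limit_stage x S -> M < m -> part p x i S m = 0.
Proof.
move=> [s0S xS SP] Mm; have m0 : m != 0 by rewrite -lt0n; apply: leq_trans Mm.
have [le_xm|lt_mx] := leqP x m; first exact: part_default.
by rewrite /part (negbTE m0) (negbTE (SP m _)) ?Mm.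
Qed.

Lemma collapse_level s : s0 <= s -> collapse p s -> M < level s.
Proof.
move=> s0s act; rewrite ltnNge; apply/negP => le_l.
have := s0P le_l (leqW s0s); rewrite candidateS act eqxx s0P //.
by move/eqP; rewrite addn1 eqn_leq ltnn.
Qed.

(** Later collapses concern only levels above [M], where [x] has coordinate 0 by now. *)
Lemma part_stable x i S S' m : limit_stage x S -> S <= S' ->
  part p x i S' m = part p x i S m.
Proof.
move=> xS /subnK<-; elim: (S' - S) => // k <-.
have [s0k xk _] := limit_stageW (leq_addl k S) xS; rewrite addSn; set s := k + S.
have sP : limit_stage x s by apply: limit_stageW xS; apply: leq_addl.
have [->|m0] := eqVneq m 0.
  rewrite partS0 //; case: ifP => act; rewrite ?addn0 //.
  by rewrite (part_vanish _ sP (collapse_level _ act)) // muln0 addn0.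
rewrite partS //; case: ifP => // /andP[act /eqP lm].
by rewrite (part_vanish _ sP) // -lm; apply: collapse_level act.
Qed.

Local Open Scope ring_scope.

Definition limit_of (x : nat) : nat := epsilon (inhabits 0%N) (limit_stage x).

Lemma limit_ofP x : limit_stage x (limit_of x).
Proof. exact: epsilon_spec (limit_stage_exists x). Qed.

(** In the limit, coordinate 0 belongs to e_0 and coordinate [m] with [0 < m <= M] to the final
    generator of level [m]; nothing else survives. *)
Definition vec (x : nat) : 'rV[rat]_M.+1 :=
  \row_m rat_of_code (coordinate p x (limit_of x) m).

Lemma vecE x S (m : 'I_M.+1) : limit_stage x S ->
  vec x 0 m = rat_of_code (coordinate p x S m).
Proof.
move=> xS; rewrite mxE /coordinate.
have eq_part i : part p x i (limit_of x) m = part p x i S m.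
  have := limit_ofP x; case: (leqP S (limit_of x)) => [le_S _|/ltnW le_S xl].
    exact: part_stable.
  by rewrite (part_stable _ _ xl).
by rewrite !eq_part.
Qed.

(** Relations in the limit are thus decided at a finite stage, without knowledge of [M] or [s0]. *)
Lemma axpy_testE a x y z : axpy_test p a x y z =
  (vec z == rat_of_code a *: vec x + vec y).
Proof.
pose S := maxn (decision_stage a x y z) (maxn (limit_of x) (maxn (limit_of y) (limit_of z))).
have limS u : (limit_of u <= S)%N -> limit_stage u S.
  by move=> uS; apply: limit_stageW (limit_ofP u).
have xS : limit_stage x S by apply: limS; rewrite /S; lia.
have yS : limit_stage y S by apply: limS; rewrite /S; lia.
have zS : limit_stage z S by apply: limS; rewrite /S; lia.
have vecP (m : 'I_M.+1) : (vec z 0 m == rat_of_code a * vec x 0 m + vec y 0 m) =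
    (axpy_defect p a x y z S m == 0).
  by rewrite (vecE _ xS) (vecE _ yS) (vecE _ zS) -axpy_defectE fma_testE.
have := axpy_testP p (leq_maxl _ _ : decision_stage a x y z <= S)%N.
set b := axpy_test _ _ _ _ _ => bP; apply/idP/eqP => [/bP W0|vz].
  by apply/rowP => m; rewrite [RHS]mxE [X in X + _]mxE; apply/eqP; rewrite vecP W0.
apply/bP => m; apply/eqP; have [lt_Mm|le_mM] := ltnP M m.
  rewrite /axpy_defect !(part_vanish _ xS) // !(part_vanish _ yS) //.
  by rewrite !(part_vanish _ zS) // !subrr !mulr0.
rewrite -(vecP (Ordinal (le_mM : (m < M.+1)%N))) vz.
by rewrite [X in X == _]mxE [X in X + _ == _]mxE.
Qed.

Definition nat_parts (z : int) : nat * nat := (`|Num.max z 0|%N, `|Num.max (- z) 0|%N).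

Lemma nat_partsE z : (nat_parts z).1%:Z - (nat_parts z).2%:Z = z.
Proof. rewrite /nat_parts /=; lia. Qed.

Lemma common_denominator (v : 'rV[rat]_M.+1) : exists d (c : nat -> int),
  forall m : 'I_M.+1, v ord0 m = (c m)%:~R / d.+1%:R.
Proof.
pose d := \prod_(m < M.+1) `|denq (v ord0 m)|%N.
have d_gt0 : (0 < d)%N by apply: prodn_gt0 => m; rewrite absz_gt0 denq_neq0.
have dvd_d m : (`|denq (v ord0 m)| %| d)%N by rewrite /d (bigD1 m) //= dvdn_mulr.
clearbody d.
exists d.-1, (fun m => numq (v ord0 (inord m)) * (d %/ `|denq (v ord0 (inord m))|)%N%:Z) => m.
rewrite inord_val prednK //; have := dvd_d m; set k := `|denq (v ord0 m)|%N => /dvdnP[q dq].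
have k_gt0 : (0 < k)%N by rewrite absz_gt0 denq_neq0.
have kE : denq (v ord0 m) = k%:Z by rewrite /k; have := denq_gt0 (v ord0 m); lia.
rewrite -{1}(divq_num_den (v ord0 m)) kE; clearbody k.
rewrite dq muln_gt0 k_gt0 andbT in d_gt0 *.
rewrite mulnK // intrM -!pmulrn natrM.
by field; rewrite !pnatr_eq0 -!lt0n k_gt0 d_gt0.
Qed.

Lemma vec_surj v : exists x, vec x = v.
Proof.
have [d [c vE]] := common_denominator v.
pose l (f : nat -> nat) n := CodeSeq.code (mkseq f n).
(* At stage [s0] the generators of levels up to [M] are final, and candidates of levels above [s0]
   are still 0, so [s0.+1] tags suffice. *)
pose x := CodeSeq.code [:: s0; d; l (fun m => (nat_parts (c m)).1) M.+1;
  l (fun m => (nat_parts (c m)).2) M.+1; l (fun m => candidate p m s0) s0.+1].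
have lE f n m : at_ (l f n) m = if (m < n)%N then f m else 0%N.
  rewrite /l at_code; case: ltnP => [lt_mn|le_nm]; first exact: nth_mkseq.
  by rewrite nth_default // size_mkseq.
have xs : stage x = s0 by rewrite /stage /x at_code.
have x_valid : valid p x.
  apply/allP => m _; rewrite xs /tag_of /x [at_ (CodeSeq.code _) 4]at_code /= lE ltnS.
  by case: leqP => // lt_m; rewrite candidate_small.
have coef2 m : coef p x 2 m = if (m < M.+1)%N then (nat_parts (c m)).1 else 0%N.
  by rewrite /coef x_valid /x [at_ (CodeSeq.code _) 2]at_code /= lE.
have coef3 m : coef p x 3 m = if (m < M.+1)%N then (nat_parts (c m)).2 else 0%N.
  by rewrite /coef x_valid /x [at_ (CodeSeq.code _) 3]at_code /= lE.
have partE i m : (forall j, (M < j)%N -> coef p x i j = 0%N) -> (m <= M)%N ->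
    part p x i (limit_of x) m = coef p x i m.
  move=> ci le_mM; have [s0S _ _] := limit_ofP x; rewrite /part xs.
  have [->|_] := eqVneq m 0%N; last by rewrite (s0P le_mM s0S) eqxx.
  (* Coordinate 0 receives nothing: from [s0] on only levels above [M] collapse, where the
     coefficients are 0. *)
  rewrite big1_seq ?addn0 // => s _; case: ifP => // /and3P[s0s act _].
  by rewrite ci ?muln0 // collapse_level.
exists x; apply/rowP => m; have mM : (m <= M)%N by rewrite -ltnS.
rewrite mxE rat_of_codeE !partE // => [|j Mj|j Mj]; last 2 first.
- by rewrite coef3 ltnS leqNgt Mj.
- by rewrite coef2 ltnS leqNgt Mj.
by rewrite coef2 coef3 ltn_ord vE /x at_code /= !pmulrn -intrB nat_partsE.
Qed.

Lemma candidate0 s : candidate p 0 s = 0%N.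
Proof. by elim: s => // s IHs; rewrite candidateS IHs. Qed.

Lemma candidate_limit : (M <= card_code (candidate p M s0))%N /\
  forall i, p i.+1 != candidate p M s0.
Proof.
(* The candidate of level 0 always remains the index of the empty set, which is not enumerated. *)
have [M0|M_gt0] := posnP M; last by apply: candidate_missed => // s; apply: s0P.
by rewrite M0 candidate0; split=> // i; apply: fin_enum_neq0.
Qed.

Lemma vec_invalid x : ~~ valid p x -> vec x = 0.
Proof.
move=> /negbTE x_invalid; apply/rowP => m; rewrite mxE rat_of_codeE [RHS]mxE.
have part0 i : part p x i (limit_of x) m = 0%N.
  rewrite /part /coef x_invalid if_same big1_seq ?if_same // => s _.
  by rewrite muln0 if_same.
by rewrite !part0 subrr mul0r.
Qed.

Lemma vec0 : vec 0 = 0.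
Proof.
apply/rowP => m; rewrite mxE rat_of_codeE [RHS]mxE.
have part0 i : part p 0 i (limit_of 0) m = 0%N.
  rewrite /part /coef !at0 !if_same big1_seq ?if_same // => s _.
  by rewrite muln0 if_same.
by rewrite !part0 subrr mul0r.
Qed.

(** Candidates increase to their limit, so valid codes never carry a larger tag; this lets
    [read_candidate] take a maximum. *)
Lemma tag_leq x : valid p x -> (tag_of x M <= candidate p M s0)%N.
Proof.
move=> /allP x_valid; have [lt_Mx|le_xM] := ltnP M x; last first.
  by rewrite /tag_of at_default // (leq_trans (at_leq _ _)).
rewrite (eqP (x_valid M _)) ?mem_iota // -(s0P (leqnn M) (leq_maxr (stage x) s0)).
by rewrite candidate_mono // leq_maxl.
Qed.

(** A nonzero coordinate at a positive level [M] means that the generator current when [x] was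
    created has survived, so its tag is final. *)
Lemma tag_limit x : vec x 0 ord_max != 0 -> tag_of x M = candidate p M s0.
Proof.
have [/allP x_valid|/vec_invalid->] := boolP (valid p x); last by rewrite mxE eqxx.
have [M0 _|M_gt0 xM] := posnP M.
  apply/eqP; rewrite eqn_leq tag_leq; last by apply/allP.
  by rewrite {1}M0 candidate0.
have [s0S _ _] := limit_ofP x.
have M0 : (M == 0%N) = false by rewrite eqn0Ngt M_gt0.
have xP i : part p x i (limit_of x) M != 0%N -> tag_of x M = candidate p M s0.
  have [lt_Mx|le_xM] := ltnP M x; last by rewrite part_default ?M0.
  rewrite /part M0; case: ifP => [/eqP cM _|//].
  by rewrite (eqP (x_valid M _)) ?mem_iota // cM (s0P (leqnn M) s0S).
have [p2|/xP//] := eqVneq (part p x 2 (limit_of x) M) 0%N.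
have [p3|/xP//] := eqVneq (part p x 3 (limit_of x) M) 0%N.
by move: xM; rewrite mxE rat_of_codeE p2 p3 subrr mul0r eqxx.
Qed.

End Limit.

(** * Names of the same space *)

Section Transfer.
Variables (q : baire) (n n' : nat) (F F' : fieldType) (V : lmodType F) (V' : lmodType F').
Variables (cF : F -> nat) (cF' : F' -> nat) (cV : V -> nat) (cV' : V' -> nat).
Hypotheses (qV : vs_name q n cF cV) (qV' : vs_name q n' cF' cV').
Local Open Scope ring_scope.

Lemma vs_name_maps : (exists f : F -> F', forall a, cF' (f a) = cF a) /\
  (exists f : V -> V', forall v, cV' (f v) = cV v).
Proof.
split.
  have [g cFK] := inj_cancel 0 (vs_cF_inj qV'); exists (g \o cF) => a /=.
  have [_ /(_ (ex_intro _ a erefl))/(vs_F_carrier qV')[b <-]] := vs_F_carrier qV (cF a).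
  by rewrite cFK.
have [g cVK] := inj_cancel 0 (vs_cV_inj qV'); exists (g \o cV) => v /=.
have [_ /(_ (ex_intro _ v erefl))/(vs_V_carrier qV')[u <-]] := vs_V_carrier qV (cV v).
by rewrite cVK.
Qed.

Lemma vs_name_semilinear (f : F -> F') (g : V -> V') :
    (forall a, cF' (f a) = cF a) -> (forall v, cV' (g v) = cV v) ->
  [/\ f 0 = 0, g 0 = 0 & forall (B : {fset V}) c,
    g (\sum_(b <- B) c b *: b) = \sum_(b <- B) f (c b) *: g b].
Proof.
move=> fE gE.
have g0 : g 0 = 0 by apply: (vs_cV_inj qV'); rewrite gE -(vs_V_zero qV) (vs_V_zero qV').
split=> // [|B c].
  by apply: (vs_cF_inj qV'); rewrite fE -(vs_F_zero qV) (vs_F_zero qV').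
have gD : {morph g : u v / u + v}.
  by move=> u v; apply: (vs_cV_inj qV'); rewrite gE -(vs_V_add qV) -(vs_V_add qV') !gE.
rewrite (big_morph g gD g0); apply: eq_bigr => b _; apply: (vs_cV_inj qV').
by rewrite gE -(vs_V_scale qV) -(vs_V_scale qV') fE gE.
Qed.

End Transfer.

(** A solution comes with a field and a space of its own. Both structures share the operations on
    codes, so matching codes is a semilinear isomorphism. *)
Lemma basis_transfer q n n' (F F' : fieldType) (V : lmodType F) (V' : lmodType F')
    (cF : F -> nat) (cF' : F' -> nat) (cV : V -> nat) (cV' : V' -> nat)
    (B : {fset V}) (B' : {fset V'}) :
    vs_name q n cF cV -> vs_name q n' cF' cV' -> cV @` B = cV' @` B' ->
  basis B -> basis B'.
Proof.
move=> qV qV' eqB [indB spanB].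
have [[f fE] [g gE]] := vs_name_maps qV qV'.
have [[f' fE'] [g' gE']] := vs_name_maps qV' qV.
have [f0 g0 g_lin] := vs_name_semilinear qV qV' fE gE.
have fK : cancel f' f by move=> a; apply: (vs_cF_inj qV'); rewrite fE fE'.
have gK : cancel g' g by move=> a; apply: (vs_cV_inj qV'); rewrite gE gE'.
have gK' : cancel g g' by move=> a; apply: (vs_cV_inj qV); rewrite gE' gE.
have B'E : B' = g @` B.
  apply: (imfset_inj (vs_cV_inj qV')); rewrite -eqB; apply/fsetP => x.
  apply/imfsetP/imfsetP => -[/= v vB ->].
    by exists (g v); rewrite ?gE // in_imfset.
  by move/imfsetP: vB => [/= u uB ->]; exists u; rewrite ?gE.
have sumB' (d : V' -> F') : (\sum_(b <- B') d b *: b = \sum_(b <- B) d (g b) *: g b)%R.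
  by rewrite B'E big_imfset //= => u v _ _; apply: (can_inj gK').
split=> [[d [[b bB' db0] d0]]|v].
  apply: indB; exists (fun u => f' (d (g u))); split.
    move: bB'; rewrite B'E => /imfsetP[u /= uB bu]; exists u => //.
    by apply: contraNneq db0 => du; rewrite bu -(fK (d _)) du f0.
  apply: (can_inj gK'); rewrite g_lin g0 -[RHS]d0 sumB'.
  by apply: eq_bigr => u _; rewrite fK.
have [c vc] := spanB (g' v); exists (fun u => f (c (g' u))).
by rewrite -{1}(gK v) vc g_lin sumB'; apply: eq_bigr => u _; rewrite gK'.
Qed.

(** * Bases and dimension in finite-dimensional spaces *)

Section VectType.
Variables (F : fieldType) (V : vectType F).
Local Open Scope ring_scope.

Lemma free_fsetP (B : {fset V}) : reflect (~ lin_dependent B) (free B).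
Proof.
have sumE c : \sum_(b <- B) c b *: b = \sum_(i < size B) c B`_i *: B`_i.
  by rewrite (big_nth 0) big_mkord.
have freeBP : reflect _ (free B) := @freeP F V _ (in_tuple (enum_fset B)).
apply: (iffP freeBP) => [freeB [c [[b bB cb0] c0]]|indB k k0 i].
  have lt_b : (index b B < size B)%N by rewrite index_mem.
  move: c0; rewrite sumE => /(freeB (fun i => c B`_i))/(_ (Ordinal lt_b)) /=.
  by rewrite nth_index // => /eqP; rewrite (negbTE cb0).
(* Coefficients by position become a function of the vector; each vector occurs at only one
   position. *)
pose c b := \sum_(i < size B | B`_i == b) k i.
have cE (j : 'I_#|` B|) : c B`_j = k j.
  by apply: big_pred1 => l; rewrite /= nth_uniq ?ltn_ord ?fset_uniq.
apply/eqP; apply: contraT => ki0; case: indB; exists c; split.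
  by exists B`_i; rewrite ?cE // mem_nth.
by rewrite sumE -[RHS]k0; apply: eq_bigr => j _; rewrite cE.
Qed.

Lemma basis_card (B : {fset V}) : basis B -> #|` B| = \dim {:V}.
Proof.
case=> /free_fsetP freeB spanB; rewrite -(eqP freeB); congr (\dim _).
apply/eqP; rewrite eqEsubv subvf; apply/subvP => v _; have [c ->] := spanB v.
by rewrite big_seq; apply: memv_suml => b bB; rewrite memvZ // memv_span.
Qed.

Lemma dependent_of_card (B : {fset V}) : (\dim {:V} < #|` B|)%N -> lin_dependent B.
Proof.
move=> lt_dim; apply: NNPP => /free_fsetP/eqP freeB.
by move: lt_dim; rewrite -freeB ltnNge dimvS ?subvf.
Qed.

End VectType.

(** * From enumerations to vector spaces *)

Definition axpy (p : baire) (a x y : nat) : nat := least (axpy_test p a x y).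

(* The cases follow the numbering of the components in [vs_name]. *)
Definition space_op (p : baire) (i a b : nat) : nat :=
  if i == 0 then (p 0).+1
  else if i == 1 then nat_of_bool (all (fun y => ~~ fma_test one_code a 0 y) (iota 0 a))
  else if i == 2 then 0
  else if i == 3 then least_code rat_of_code 1%R
  else if i == 4 then fma one_code a b
  else if i == 5 then fma opp_one_code a 0
  else if i == 6 then fma a b 0
  else if i == 7 then nat_of_bool (all (fun y => ~~ axpy_test p one_code a 0 y) (iota 0 a))
  else if i == 8 then 0
  else if i == 9 then axpy p one_code a b
  else axpy p a b 0.

Definition space_name (p : baire) (k : nat) : nat :=
  space_op p (at_ k 0) (at_ k 1) (at_ k 2).

Lemma component_space p i s :
  component (space_name p) i s = space_op p i (nth 0 s 0) (nth 0 s 1).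
Proof. by rewrite /component /space_name !at_code. Qed.

(** Every vector of the limit has a code, so the search for a sum ends. *)
Lemma axpy_test_total p a x y : C_max_instance p -> exists z, axpy_test p a x y z.
Proof.
move=> pI; have [M [mM not_mM]] := missed_top pI.
have [s0 s0P] := candidates_stable mM.
have [z zE] := vec_surj not_mM s0P
  (rat_of_code a *: vec p M s0 x + vec p M s0 y)%R.
by exists z; rewrite (axpy_testE not_mM s0P) zE.
Qed.

Lemma comp_axpy f g h : computable C_max_instance f -> computable C_max_instance g ->
  computable C_max_instance h ->
  computable C_max_instance (fun p e => axpy p (f p e) (g p e) (h p e)).
Proof.
apply: (@comp_app3 _ axpy).
apply: (comp_mu (h := fun p z e => axpy_test p (nth 0 e 2) (nth 0 e 1) (nth 0 e 0) z)).
- by apply: comp_axpy_test; auto with comp.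
- by move=> p pI e; case: (leastP (axpy_test_total (nth 0 e 2) (nth 0 e 1) (nth 0 e 0) pI)).
- move=> p pI e i.
  by case: (leastP (axpy_test_total (nth 0 e 2) (nth 0 e 1) (nth 0 e 0) pI)) => _; apply.
Qed.
#[local] Hint Resolve comp_axpy : comp.

Lemma comp_space_name : computable C_max_instance (fun p e => space_name p (nth 0 e 0)).
Proof.
rewrite /space_name /space_op; auto 60 with comp.
Qed.

(** A basis has [M.+1] elements, so the level consulted is [M], and its largest tag there is the
    final candidate. *)
Definition read_candidate (r : nat) : nat :=
  \max_(0 <= x < r) if bit r x then tag_of x (card_code r).-1 else 0.

Lemma comp_read_candidate D :
  computable D (fun p e => read_candidate (p 0)).
Proof. by rewrite /read_candidate /tag_of; auto 60 with comp. Qed.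

Section Space.
Variables (p : baire) (M s0 : nat).
Hypothesis pI : C_max_instance p.
Hypotheses (missedM : missed p M) (not_missed : forall m, M < m -> ~ missed p m).
Hypothesis s0P : forall m s, m <= M -> s0 <= s -> candidate p m s = candidate p m s0.
Local Notation vec := (vec p M s0).
Local Notation vec_surj := (vec_surj not_missed s0P).
Local Notation code_rat := (least_code rat_of_code).
Local Notation code_vec := (least_code vec).
Local Open Scope ring_scope.

Lemma axpyE a x y : axpy p a x y = code_vec (rat_of_code a *: vec x + vec y).
Proof.
rewrite /axpy /least_code; congr least; apply: functional_extensionality => z.
exact: axpy_testE.
Qed.

Lemma space_nameP : vs_name (space_name p) (p 0%N).+1 code_rat code_vec.
Proof.
have ratK := least_codeK rat_of_code_surj; have vecK := least_codeK vec_surj.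
have b2n (b : bool) : (nat_of_bool b != 0%N) = b by case: b.
split=> [|||x|||a b|a|a b|x||u v|a v]; rewrite ?component_space /space_op /= ?fmaE ?axpyE ?ratK ?vecK //.
- exact: can_inj ratK.
- exact: can_inj vecK.
(* With multiplier 1 and summand 0 the test is equality of values. *)
- rewrite b2n (eq_all (a2 := fun y => rat_of_code y != rat_of_code x)).
    by symmetry; apply: least_codeE rat_of_code_surj _.
  by move=> y; rewrite fma_testE rat_of_one_code rat_of_code0 mul1r addr0.
- by rewrite -{1}rat_of_code0 least_code0 //; apply: rat_of_code_surj.
- by rewrite rat_of_one_code mul1r.
- by rewrite rat_of_opp_one_code mulN1r rat_of_code0 addr0.
- by rewrite rat_of_code0 addr0.
- rewrite b2n (eq_all (a2 := fun y => vec y != vec x)).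
    by symmetry; apply: least_codeE vec_surj _.
  by move=> y; rewrite (axpy_testE not_missed s0P) // rat_of_one_code vec0 scale1r addr0.
- by rewrite -(vec0 p M s0) least_code0 //; apply: vec_surj.
- by rewrite rat_of_one_code scale1r.
- by rewrite vec0 addr0.
Qed.

Lemma dim_space : \dim {: 'rV[rat]_M.+1} = M.+1.
Proof. by rewrite dimvf /dim /= mul1n. Qed.

Lemma space_instance : VSB_instance (space_name p).
Proof.
exists (p 0%N).+1, rat, 'rV[rat]_M.+1, code_rat, code_vec; split; first exact: space_nameP.
move=> B B_card; apply: dependent_of_card.
(* From [M < p 0] the dimension [M.+1] is at most [p 0], hence the bound [(p 0).+1] in the name. *)
by rewrite dim_space B_card ltnS; apply: missed_lt.
Qed.

Lemma read_candidateE r : VSB_solution (space_name p) r ->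
  read_candidate (r 0%N) = candidate p M s0.
Proof.
case=> n [F [V [cF [cV [qV [B' B'_basis rB']]]]]].
have vecK := least_codeK vec_surj.
(* Both names decide the same carrier, so the solution consists of codes of vectors of the
   constructed space. *)
have [x rx|B rB] := fset_image_code space_nameP (e := r 0%N).
  apply/(vs_V_carrier space_nameP)/(vs_V_carrier qV); move: rx.
  by rewrite -mem_Dset rB' => /imfsetP[v _ ->]; exists v.
have B_basis : basis B.
  by apply: (basis_transfer qV space_nameP _ B'_basis); rewrite -rB.
have -> : read_candidate (r 0%N) = \max_(x <- Dset (r 0%N)) tag_of x M.
  rewrite /read_candidate -card_Dset rB card_imfset /=; last exact: can_inj vecK.
  rewrite basis_card // dim_space -rB -big_mkcond.
  by rewrite (perm_big _ (perm_Dset _)) big_filter /index_iota subn0.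
apply/eqP; rewrite eqn_leq; apply/andP; split.
  apply/bigmax_leqP_seq => x; rewrite rB => /imfsetP[/= b bB ->] _.
  (* An invalid code denotes 0, which no basis contains. *)
  apply: tag_leq => //; apply: contraT => /(vec_invalid M s0).
  rewrite vecK => b0; case: B_basis.1; exists (fun v => (v == 0)%:R); split.
    by exists b; rewrite // b0 eqxx oner_eq0.
  by rewrite big1 // => v _; case: eqP => [->|_]; rewrite ?scaler0 ?scale0r.
(* Otherwise the last unit vector would lie outside the span. *)
have [b bB bM] : exists2 b, b \in B & b 0 ord_max != 0.
  apply: NNPP => noB; have [c /(congr1 (fun v : 'rV_M.+1 => v 0 ord_max))] := B_basis.2 (delta_mx 0 ord_max).
  rewrite mxE !eqxx summxE big1_seq => [/eqP|b /= bB]; first by rewrite oner_eq0.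
  rewrite mxE; case: (eqVneq (b 0 ord_max) 0) => [->|bM]; first by rewrite mulr0.
  by case: noB; exists b.
rewrite -(tag_limit not_missed s0P (x := code_vec b)) ?vecK //.
by apply: (leq_bigmax_seq (F := fun x => tag_of x M)); rewrite // rB in_imfset.
Qed.

(** The final candidate has at least [M] elements, so a proper superset outside the range would
    contradict the choice of [M]. *)
Lemma limit_candidate_maximal (t : baire) : t 0%N = candidate p M s0 ->
  C_max_solution p t.
Proof.
rewrite /C_max_solution /nat_of_name => ->.
have [le_M cP] := candidate_limit pI s0P.
split=> [k /fin_enumE|Y]; first by rewrite (negbTE (cP k)).
have [e <-] := Dset_surj Y => /fproper_ltn_card; rewrite !card_Dset => lt_e.
apply: NNPP => eP; apply: (not_missed (leq_ltn_trans le_M lt_e)).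
by exists e => // i; apply/negP => /fin_enumE ei; apply: eP; exists i.
Qed.

End Space.

(** [Psi] sees only the basis; the tags in its vectors replace access to [p], as strong reducibility
    demands. *)
Lemma C_max_le_VSB_fin : sW_reducible C_max VSB_fin.
Proof.
have [Phi PhiE] := comp_space_name.
have [Psi PsiE] := comp_read_candidate (fun _ => True).
exists Phi, Psi => p pI; have [M [mM not_mM]] := missed_top pI.
have [s0 s0P] := candidates_stable mM.
exists (space_name p); split; first by move=> k; apply: (PhiE p pI [:: k]).
  exact: (space_instance pI mM not_mM s0P).
move=> r /(read_candidateE not_mM s0P) rE; exists (fun=> read_candidate (r 0)).
  by move=> k; apply: (PsiE r I).
exact: (limit_candidate_maximal pI not_mM s0P rE).
Qed.

Theorem theorem3p10 : sW_equiv VSB_fin C_max.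
Proof. by split; [apply: VSB_fin_le_C_max | apply: C_max_le_VSB_fin]. Qed.
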